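(* There exist absolute constants $c>0$, $c_0>0$ and $c_1>0$ such that the following holds. Let $\bm{M}_{\star}\in\mathbb{R}^{n_1\times n_2}$ have rank $r$, with ground-truth factors $\bm{X}_\star,\bm{Y}_\star$ and condition number $\kappa$ as defined in the context, and let $\bm{A}_1,\dots,\bm{A}_m\in\mathbb{R}^{n_1\times n_2}$ be sensing matrices with measurements $y_i=\langle \bm{A}_i,\bm{M}_\star\rangle$, $i=1,\dots,m$. Suppose the operator $\mathcal{A}$ satisfies the rank-$2r$ RIP with constant $\delta_{2r}\le c$. Let $\bm{Z}_0=\begin{bmatrix}\bm{X}_0\\ \bm{Y}_0\end{bmatrix}\in\mathbb{R}^{(n_1+n_2)\times r}$ be any initialization point satisfying \[ \min_{\bm{R}\in\mathcal{O}^{r\times r}}\|\bm{Z}_0\bm{R}-\bm{Z}_\star\|_{\mathrm{F}}\le c_0\,\frac{1}{\kappa^{3/2}}\,\sigma_{\min}^{1/2}. \] Run gradient descent with constant step size $\eta_t=\eta=c_1$: \[ \bm{X}_{t+1}=\bm{X}_t-\frac{\eta}{\|\bm{Y}_0\|^2}\sum_{i=1}^m\big(\langle\bm{A}_i,\bm{X}_t\bm{Y}_t^\top\rangle-y_i\big)\bm{A}_i\bm{Y}_t,\qquad \bm{Y}_{t+1}=\bm{Y}_t-\frac{\eta}{\|\bm{X}_0\|^2}\sum_{i=1}^m\big(\langle\bm{A}_i,\bm{X}_t\bm{Y}_t^\top\rangle-y_i\big)\bm{A}_i^\top\bm{X}_t, \] and let $\bm{Z}_t=\begin{bmatrix}\bm{X}_t\\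 \bm{Y}_t\end{bmatrix}$. Then for all $t\ge 0$, \[ \mathrm{dist}(\bm{Z}_t,\bm{Z}_\star)\le\Big(1-\frac{\eta}{50\kappa}\Big)^t\,\mathrm{dist}(\bm{Z}_0,\bm{Z}_\star). \]
   Context: $\bm{M}_\star\in\mathbb{R}^{n_1\times n_2}$ has rank $r$ and compact SVD $\bm{M}_\star=\bm{U}_\star\bm{\Sigma}_\star\bm{V}_\star^\top$; the ground-truth factors are $\bm{X}_\star=\bm{U}_\star\bm{\Sigma}_\star^{1/2}\in\mathbb{R}^{n_1\times r}$, $\bm{Y}_\star=\bm{V}_\star\bm{\Sigma}_\star^{1/2}\in\mathbb{R}^{n_2\times r}$, and $\bm{Z}_\star=\begin{bmatrix}\bm{X}_\star\\ \bm{Y}_\star\end{bmatrix}$. $\sigma_{\max}=\sigma_1(\bm{M}_\star)$, $\sigma_{\min}=\sigma_r(\bm{M}_\star)$, $\kappa=\sigma_{\max}/\sigma_{\min}$. $\mathcal{A}:\mathbb{R}^{n_1\times n_2}\to\mathbb{R}^m$ is $\mathcal{A}(\bm{M})=(\langle\bm{A}_i,\bm{M}\rangle)_{1\le i\le m}$, with $\langle\bm{X},\bm{Y}\rangle=\mathrm{Tr}(\bm{Y}^\top\bm{X})$. $\mathcal{A}$ satisfies the rank-$k$ RIP with constant $\delta_k\in[0,1)$ if $(1-\delta_k)\|\bm{M}\|_{\mathrm{F}}^2\le\|\mathcal{A}(\bm{M})\|_2^2\le(1+\delta_k)\|\bm{M}\|_{\mathrm{F}}^2$ for all $\bm{M}$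 of rank at most $k$. $\mathcal{O}^{r\times r}$ is the set of $r\times r$ orthogonal matrices; $\|\cdot\|$ is the spectral norm. For $\bm{Z}=\begin{bmatrix}\bm{X}\\ \bm{Y}\end{bmatrix}$ with $\bm{X}\in\mathbb{R}^{n_1\times r},\bm{Y}\in\mathbb{R}^{n_2\times r}$, \[ \mathrm{dist}(\bm{Z},\bm{Z}_\star)=\inf_{\bm{P}\in\mathbb{R}^{r\times r}\text{ invertible}}\sqrt{\|\bm{X}\bm{P}-\bm{X}_\star\|_{\mathrm{F}}^2+\|\bm{Y}\bm{P}^{-\top}-\bm{Y}_\star\|_{\mathrm{F}}^2}, \] where $\bm{P}^{-\top}=(\bm{P}^{-1})^\top$. *)

(* Defs.v *)
From mathcomp Require Import all_boot all_order all_algebra.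
From mathcomp Require Import classical_sets reals.
Set Implicit Arguments.
Unset Strict Implicit.
Unset Printing Implicit Defensive.
Import Order.TTheory GRing.Theory Num.Theory.
Local Open Scope ring_scope.
Local Open Scope classical_set_scope.

Section Defs.
Variable R : realType.

Definition mxinner (p q : nat) (X Y : 'M[R]_(p, q)) : R := \tr (Y^T *m X).

Definition frob (p q : nat) (X : 'M[R]_(p, q)) : R :=
  Num.sqrt (\sum_(i < p) \sum_(j < q) X i j ^+ 2).

Definition vnorm (q : nat) (v : 'cV[R]_q) : R := Num.sqrt (\sum_(j < q) v j 0 ^+ 2).

Definition specnorm (p q : nat) (X : 'M[R]_(p, q)) : R :=
  sup [set x | exists v : 'cV[R]_q, vnorm v = 1 /\ x = vnorm (X *m v)].

Definition opA (n1 n2 m : nat) (A : 'I_m -> 'M[R]_(n1, n2)) (M : 'M[R]_(n1, n2))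
  : 'I_m -> R := fun i => mxinner (A i) M.

Definition sqnorm_opA (n1 n2 m : nat) (A : 'I_m -> 'M[R]_(n1, n2)) (M : 'M[R]_(n1, n2)) : R :=
  \sum_(i < m) (opA A M i) ^+ 2.

Definition RIP (n1 n2 m : nat) (A : 'I_m -> 'M[R]_(n1, n2)) (k : nat) (delta : R) : Prop :=
  0 <= delta < 1 /\
  forall M : 'M[R]_(n1, n2), (\rank M <= k)%N ->
    (1 - delta) * frob M ^+ 2 <= sqnorm_opA A M /\
    sqnorm_opA A M <= (1 + delta) * frob M ^+ 2.

Definition orthogonal_mx (r : nat) (Q : 'M[R]_r) : Prop := Q^T *m Q = 1%:M.

(* min_{R orthogonal} || Z R - Zs ||_F (the min is attained; written as inf) *)
Definition orth_dist (p r : nat) (Z Zs : 'M[R]_(p, r)) : R :=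
  inf [set x | exists Q : 'M[R]_r, orthogonal_mx Q /\ x = frob (Z *m Q - Zs)].

Definition dist (n1 n2 r : nat) (X Xs : 'M[R]_(n1, r)) (Y Ys : 'M[R]_(n2, r)) : R :=
  inf [set x | exists P : 'M[R]_r, P \in unitmx /\
        x = Num.sqrt (frob (X *m P - Xs) ^+ 2 + frob (Y *m (invmx P)^T - Ys) ^+ 2)]
  : R.

Definition resid (n1 n2 r m : nat) (A : 'I_m -> 'M[R]_(n1, n2)) (y : 'I_m -> R)
  (X : 'M[R]_(n1, r)) (Y : 'M[R]_(n2, r)) : 'M[R]_(n1, n2) :=
  \sum_(i < m) (mxinner (A i) (X *m Y^T) - y i) *: A i.

Fixpoint gd (n1 n2 r m : nat) (A : 'I_m -> 'M[R]_(n1, n2)) (y : 'I_m -> R) (eta : R)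
  (X0 : 'M[R]_(n1, r)) (Y0 : 'M[R]_(n2, r)) (t : nat) : 'M[R]_(n1, r) * 'M[R]_(n2, r) :=
  match t with
  | 0 => (X0, Y0)
  | t'.+1 =>
      let: (X, Y) := gd A y eta X0 Y0 t' in
      let G := resid A y X Y in
      (X - (eta / specnorm Y0 ^+ 2) *: (G *m Y),
       Y - (eta / specnorm X0 ^+ 2) *: (G^T *m X))
  end.

End Defs.

(* Main.v *)
Require Import Defs.
From mathcomp Require Import all_boot all_order all_algebra.
From mathcomp Require Import classical_sets reals.
From mathcomp Require Import ring lra.
Set Implicit Arguments.
Unset Strict Implicit.
Unset Printing Implicit Defensive.
Import Order.TTheory GRing.Theory Num.Theory.
Local Open Scope ring_scope.

(** Fix [P] nearly attaining [dist Z_t Zs]^2 up to [tau], and write [X = X_t P],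
[Y = Y_t P^-T], [dX = X - Xs], [dY = Y - Ys].  Comparing [P] with [P (1 - s g)]
shows that the gauge gradient [g = X^T dX - dY^T Y] has size O(sqrt tau).  As
[2 <dX Y^T, X dY^T> = |X^T dX|^2 + |dY^T Y|^2 - |g|^2], the linearised residual
[H = dX Y^T + X dY^T] satisfies [|H|^2 >= (9/10 l)^2 (|dX|^2 + |dY|^2) - |g|^2],
with [l^2 = smin].  One gradient step, read in the coordinates of [P],
right-multiplies the two gradients by [P^T P] and its inverse; when these are
within [O(kappa^(-1/2))] of the identity, the RIP makes the step decrease
[|dX|^2 + |dY|^2] by a fixed multiple of [eta |H|^2 / smax].  Two good alignments
of the same point differ by [O(dist / l)], so the drift of [P^T P] away from the
identity is a geometric sum bounded by [c0 kappa^(-1/2) / eta].  Letting [tau]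
tend to [0] avoids having to show that the infimum is attained. *)

(** * Frobenius inner product and norm *)

Section Frobenius.
Context {R : realType}.
Implicit Types p q : nat.

Lemma mxinnerE p q (X Y : 'M[R]_(p, q)) :
  mxinner X Y = \sum_i \sum_j X i j * Y i j.
Proof.
rewrite /mxinner /mxtrace [RHS]exchange_big /=. apply: eq_bigr => j _.
by rewrite !mxE; apply: eq_bigr => i _; rewrite !mxE mulrC.
Qed.

Lemma mxinnerC p q (X Y : 'M[R]_(p, q)) : mxinner X Y = mxinner Y X.
Proof. by rewrite /mxinner -mxtrace_tr trmx_mul trmxK. Qed.

Lemma mxinner_trace p q (X Y : 'M[R]_(p, q)) : mxinner X Y = \tr (X^T *m Y).
Proof. by rewrite mxinnerC. Qed.

Lemma mxinnerDr p q (X Y Z : 'M[R]_(p, q)) :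
  mxinner X (Y + Z) = mxinner X Y + mxinner X Z.
Proof. by rewrite !mxinner_trace mulmxDr mxtraceD. Qed.

Lemma mxinnerDl p q (X Y Z : 'M[R]_(p, q)) :
  mxinner (Y + Z) X = mxinner Y X + mxinner Z X.
Proof. by rewrite !(mxinnerC _ X) mxinnerDr. Qed.

Lemma mxinnerZr p q a (X Y : 'M[R]_(p, q)) :
  mxinner X (a *: Y) = a * mxinner X Y.
Proof. by rewrite !mxinner_trace -scalemxAr mxtraceZ. Qed.

Lemma mxinnerZl p q a (X Y : 'M[R]_(p, q)) :
  mxinner (a *: X) Y = a * mxinner X Y.
Proof. by rewrite mxinnerC mxinnerZr mxinnerC. Qed.

Lemma mxinnerNr p q (X Y : 'M[R]_(p, q)) : mxinner X (- Y) = - mxinner X Y.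
Proof. by rewrite -scaleN1r mxinnerZr mulN1r. Qed.

Lemma mxinnerNl p q (X Y : 'M[R]_(p, q)) : mxinner (- X) Y = - mxinner X Y.
Proof. by rewrite mxinnerC mxinnerNr mxinnerC. Qed.

Lemma mxinner_tr p q (X Y : 'M[R]_(p, q)) : mxinner X^T Y^T = mxinner X Y.
Proof. by rewrite mxinner_trace trmxK mxtrace_mulC. Qed.

Lemma mxinnerMl p q k (X : 'M[R]_(p, k)) (Y : 'M[R]_(k, q)) Z :
  mxinner (X *m Y) Z = mxinner Y (X^T *m Z).
Proof. by rewrite !mxinner_trace trmx_mul -mulmxA. Qed.

Lemma mxinnerMr p q k (X : 'M[R]_(p, k)) (Y : 'M[R]_(k, q)) Z :
  mxinner (X *m Y) Z = mxinner X (Z *m Y^T).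
Proof. by rewrite !mxinner_trace trmx_mul -mulmxA mxtrace_mulC -mulmxA. Qed.

Lemma frob_ge0 p q (X : 'M[R]_(p, q)) : 0 <= frob X.
Proof. exact: sqrtr_ge0. Qed.

Lemma sqr_frob p q (X : 'M[R]_(p, q)) : frob X ^+ 2 = mxinner X X.
Proof.
rewrite sqr_sqrtr ?mxinnerE; first by do 2 apply: eq_bigr => ? _; rewrite expr2.
by do 2 apply: sumr_ge0 => ? _; exact: sqr_ge0.
Qed.

Lemma frob_eq p q p' q' (X : 'M[R]_(p, q)) (Y : 'M[R]_(p', q')) :
  mxinner X X = mxinner Y Y -> frob X = frob Y.
Proof.
rewrite -!sqr_frob => /eqP.
by rewrite eqrXn2 ?frob_ge0 // => /eqP.
Qed.

Lemma frob_tr p q (X : 'M[R]_(p, q)) : frob X^T = frob X.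
Proof. by apply: frob_eq; rewrite mxinner_tr. Qed.

Lemma frobN p q (X : 'M[R]_(p, q)) : frob (- X) = frob X.
Proof. by apply: frob_eq; rewrite mxinnerNl mxinnerNr opprK. Qed.

Lemma frobZ p q a (X : 'M[R]_(p, q)) : frob (a *: X) = `|a| * frob X.
Proof.
apply/eqP; rewrite -(@eqrXn2 _ 2) ?frob_ge0 ?mulr_ge0 ?frob_ge0 //.
by rewrite exprMn !sqr_frob mxinnerZl mxinnerZr mulrA -expr2 real_normK ?num_real.
Qed.

Lemma frob0_eq0 p q (X : 'M[R]_(p, q)) : frob X = 0 -> X = 0.
Proof.
move=> X0; have := sqr_frob X; rewrite X0 expr0n /= mxinnerE => /esym/eqP.
rewrite psumr_eq0 => [/allP s0|i _]; last by apply: sumr_ge0 => j _; rewrite -expr2 sqr_ge0.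
apply/matrixP => i j; rewrite mxE.
have := s0 i (mem_index_enum i); rewrite psumr_eq0 => [/allP s1|k _].
  by have := s1 j (mem_index_enum j); rewrite -expr2 sqrf_eq0 => /eqP.
by rewrite -expr2 sqr_ge0.
Qed.

Lemma mxinner0l p q (X : 'M[R]_(p, q)) : mxinner 0 X = 0.
Proof. by rewrite !mxinner_trace trmx0 mul0mx mxtrace0. Qed.

(** Cauchy-Schwarz: with zero matrices set aside, expand the square of [frob Y *: X - frob X *: Y]
    and cancel [frob X * frob Y]. *)
Lemma mxinner_le p q (X Y : 'M[R]_(p, q)) : mxinner X Y <= frob X * frob Y.
Proof.
have [->|x0] := eqVneq X 0; first by rewrite mxinner0l mulr_ge0 ?frob_ge0.
have [->|y0] := eqVneq Y 0; first by rewrite mxinnerC mxinner0l mulr_ge0 ?frob_ge0.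
have xp : 0 < frob X.
  by rewrite lt0r frob_ge0 andbT; apply: contra_neq x0; exact: frob0_eq0.
have yp : 0 < frob Y.
  by rewrite lt0r frob_ge0 andbT; apply: contra_neq y0; exact: frob0_eq0.
have := sqr_ge0 (frob (frob Y *: X - frob X *: Y)).
rewrite sqr_frob !(mxinnerDl, mxinnerDr, mxinnerNl, mxinnerNr, mxinnerZl, mxinnerZr).
rewrite (mxinnerC Y X) -!sqr_frob => h.
have h2 : 0 <= (frob X * frob Y) * (frob X * frob Y - mxinner X Y) by nra.
by move: h2; rewrite pmulr_rge0 ?mulr_gt0 // subr_ge0.
Qed.

Lemma mxinner_ge p q (X Y : 'M[R]_(p, q)) : - (frob X * frob Y) <= mxinner X Y.
Proof. by rewrite lerNl -mxinnerNl -(frobN X) mxinner_le. Qed.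

Lemma le_of_sqr (x y : R) : 0 <= y -> x ^+ 2 <= y ^+ 2 -> x <= y.
Proof. by move=> y0 h; nra. Qed.

Lemma frobD_le p q (X Y : 'M[R]_(p, q)) : frob (X + Y) <= frob X + frob Y.
Proof.
apply: le_of_sqr; first by rewrite addr_ge0 ?frob_ge0.
rewrite sqr_frob !(mxinnerDl, mxinnerDr) (mxinnerC Y X) -!sqr_frob.
have := mxinner_le X Y; nra.
Qed.

Lemma frobB_le p q (X Y : 'M[R]_(p, q)) : frob (X - Y) <= frob X + frob Y.
Proof. by rewrite -(frobN Y) frobD_le. Qed.

Lemma frobB_ge p q (X Y : 'M[R]_(p, q)) : frob X - frob Y <= frob (X - Y).
Proof. by rewrite lerBlDr -{1}(subrK Y X) frobD_le. Qed.


Lemma sqr_mxinner_le p q (X Y : 'M[R]_(p, q)) :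
  mxinner X Y ^+ 2 <= mxinner X X * mxinner Y Y.
Proof.
have := mxinner_le X Y; have := mxinner_ge X Y.
rewrite -!sqr_frob -exprMn; move: (mxinner X Y) (frob X * frob Y) => a b.
by move=> h1 h2; nra.
Qed.

(** Cauchy-Schwarz applied to each entry of the product, an inner product of a row of [X] and a
    column of [Y]. *)
Lemma frobM_le p q k (X : 'M[R]_(p, k)) (Y : 'M[R]_(k, q)) :
  frob (X *m Y) <= frob X * frob Y.
Proof.
apply: le_of_sqr; first by rewrite mulr_ge0 ?frob_ge0.
rewrite exprMn -(frob_tr Y) !sqr_frob !mxinnerE mulr_suml.
apply: ler_sum => i _; rewrite mulr_sumr.
apply: ler_sum => j _.
have -> : (X *m Y) i j = mxinner (row i X) (row j Y^T).
  by rewrite mxinnerE big_ord1 mxE; apply: eq_bigr => l _; rewrite !mxE.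
rewrite -expr2; apply: le_trans (sqr_mxinner_le _ _) _.
rewrite !mxinnerE !big_ord1 le_eqVlt; apply/orP; left; apply/eqP.
by congr (_ * _); apply: eq_bigr => l _; rewrite !mxE.
Qed.

End Frobenius.

(** * Operator bounds and restricted isometry *)

Section Bounds.
Context {R : realType}.
Implicit Types p q r : nat.

Lemma sqr_frobD p q (X Y : 'M[R]_(p, q)) :
  frob (X + Y) ^+ 2 = frob X ^+ 2 + 2 * mxinner X Y + frob Y ^+ 2.
Proof.
by rewrite !sqr_frob !(mxinnerDl, mxinnerDr) (mxinnerC Y X); ring.
Qed.

Lemma sqr_frobB p q (X Y : 'M[R]_(p, q)) :
  frob (X - Y) ^+ 2 = frob X ^+ 2 - 2 * mxinner X Y + frob Y ^+ 2.
Proof. by rewrite sqr_frobD frobN mxinnerNr; ring. Qed.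

(** For [0 <= l] this places the singular values of [X] in [[l, L]]. Testing on matrices [T] instead
    of vectors yields Frobenius bounds on products directly. *)
Definition mx_bounds p r (X : 'M[R]_(p, r)) (l L : R) :=
  forall q (T : 'M[R]_(r, q)), l * frob T <= frob (X *m T) <= L * frob T.

Lemma mx_bounds_perturb p r (X Y : 'M[R]_(p, r)) l L e :
  mx_bounds X l L -> frob (Y - X) <= e -> mx_bounds Y (l - e) (L + e).
Proof.
move=> hX he q T; have /andP[h1 h2] := hX q T.
have h3 : frob ((Y - X) *m T) <= e * frob T.
  by apply: le_trans (frobM_le _ _) _; rewrite ler_wpM2r ?frob_ge0.
have -> : Y *m T = X *m T + (Y - X) *m T by rewrite mulmxBl addrC subrK.
have := frobD_le (X *m T) ((Y - X) *m T).
have := frobB_ge (X *m T) (- ((Y - X) *m T)); rewrite opprK frobN.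
by move=> h4 h5; apply/andP; split; lra.
Qed.

Lemma mx_bounds_trr p r (X : 'M[R]_(p, r)) l L q (T : 'M[R]_(q, r)) :
  mx_bounds X l L -> l * frob T <= frob (T *m X^T) <= L * frob T.
Proof. by move=> hX; rewrite -(frob_tr (_ *m _)) trmx_mul trmxK -(frob_tr T). Qed.

(** A matrix and its transpose have the same operator norm: [|X^T T|^2 = <T, X X^T T>] is at most
    [|T| L |X^T T|], and one factor cancels. *)
Lemma mx_bounds_trl p r (X : 'M[R]_(p, r)) l L q (T : 'M[R]_(p, q)) :
  0 <= L -> mx_bounds X l L -> frob (X^T *m T) <= L * frob T.
Proof.
move=> L0 hX; have /andP[_ h] := hX q (X^T *m T).
have [x0|x0] := leP (frob (X^T *m T)) 0.
  by apply: le_trans x0 _; rewrite mulr_ge0 ?frob_ge0.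
rewrite -(ler_pM2r x0) -expr2 sqr_frob mxinnerMl trmxK.
apply: le_trans (mxinner_le _ _) _; have := frob_ge0 T; nra.
Qed.

(** An operator-norm bound on [W - 1], for right multiplication; all heights [p] are allowed so that
    one [W] can act on either factor. *)
Definition near_id r (W : 'M[R]_r) (w : R) :=
  forall p (T : 'M[R]_(p, r)), frob (T *m W - T) <= w * frob T.

Lemma mxrank_sumM_le n1 n2 r (X1 X2 : 'M[R]_(n1, r)) (Y1 Y2 : 'M[R]_(r, n2)) :
  (\rank (X1 *m Y1 + X2 *m Y2)%R <= 2 * r)%N.
Proof.
apply: leq_trans (mxrank_add _ _) _; rewrite mul2n -addnn.
by apply: leq_add; apply: leq_trans (mxrankM_maxl _ _) (rank_leq_col _).
Qed.

(** * The normal operator under restricted isometry *)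

Section Measurement.
Context {n1 n2 m : nat}.
Implicit Types (A : 'I_m -> 'M[R]_(n1, n2)) (E N : 'M[R]_(n1, n2)).

(** The composite of the measurement map and its adjoint; at [E = X Y^T - M] it is the gradient of
    half the squared residual with respect to the product. *)
Definition normal_op A E := \sum_(i < m) mxinner (A i) E *: A i.

Lemma mxinner_normal A E N :
  mxinner (normal_op A E) N = \sum_(i < m) mxinner (A i) E * mxinner (A i) N.
Proof.
rewrite /normal_op (big_morph (fun M => mxinner M N) (mxinnerDl N) (mxinner0l N)).
by apply: eq_bigr => i _; rewrite mxinnerZl.
Qed.

Lemma mxinner_normal_polar A E N :
  4 * mxinner (normal_op A E) N = sqnorm_opA A (E + N) - sqnorm_opA A (E - N).
Proof.
rewrite mxinner_normal /sqnorm_opA /opA mulr_sumr -sumrB.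
by apply: eq_bigr => i _; rewrite !mxinnerDr mxinnerNr; ring.
Qed.

Lemma mxinner_normal_le A E N (a : R) : 0 < a ->
  2 * a * mxinner (normal_op A E) N <= a ^+ 2 * sqnorm_opA A E + sqnorm_opA A N.
Proof.
move=> a0; rewrite mxinner_normal /sqnorm_opA /opA !mulr_sumr -big_split /=.
apply: ler_sum => i _; move: (mxinner (A i) E) (mxinner (A i) N) => x y.
by have := sqr_ge0 (a * x - y); nra.
Qed.

(** The RIP says nothing about [G] itself, whose rank is uncontrolled. But [|G Y|^2 = <G, N>] with
    [N = G Y Y^T] of rank at most [r], so both arguments of the bilinear form have low rank. *)
Lemma frob_normalM_le A k delta r (K : R) E (Y : 'M[R]_(n2, r)) :
  RIP A k delta -> delta <= 1/10 -> (r <= k)%N -> (\rank E <= k)%N -> 0 < K ->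
  (forall q (T : 'M[R]_(q, r)), frob (T *m Y^T) <= K * frob T) ->
  frob (normal_op A E *m Y) ^+ 2 <= 2 * K ^+ 2 * frob E ^+ 2.
Proof.
move=> [_ rip] hd rk rE K0 hY; set G := normal_op A E.
have -> : frob (G *m Y) ^+ 2 = mxinner G (G *m Y *m Y^T).
  by rewrite sqr_frob -mxinnerMr.
set N := G *m Y *m Y^T.
have rN : (\rank N <= k)%N.
  by apply: leq_trans (mxrankM_maxr _ _) (leq_trans _ rk); rewrite rank_leq_row.
have [_ h1] := rip _ rE; have [_ h2] := rip _ rN.
have K2 : 0 < K ^+ 2 by rewrite exprn_gt0.
(* This weight makes the [sqnorm_opA A N] term of the weighted AM-GM inequality at most half of its
   left side, where it is absorbed. *)
have a0 : 0 < 11/10 * K ^+ 2 by lra.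
have h3 := mxinner_normal_le A E N a0.
have hN : frob N ^+ 2 <= K ^+ 2 * mxinner G N.
  have -> : mxinner G N = frob (G *m Y) ^+ 2 by rewrite sqr_frob -mxinnerMr.
  rewrite -exprMn lerXn2r ?nnegrE ?frob_ge0 ?mulr_ge0 ?frob_ge0 ?(ltW K0) ?hY //.
move: h3; rewrite -/G; move: hN h1 h2; set x := mxinner G N.
have x0 : 0 <= x by rewrite /x -mxinnerMr -sqr_frob sqr_ge0.
have := sqr_ge0 (frob E); have := sqr_ge0 (frob N).
move: (frob E ^+ 2) (frob N ^+ 2) (sqnorm_opA A E) (sqnorm_opA A N) (K ^+ 2) K2 a0.
move=> e n sE sN k2 k20 _ n0 e0 hN h1 h2 h3.
have h1' : sE <= 11/10 * e by nra.
have h2' : sN <= 11/10 * n by nra.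
have h4 : (11/10 * k2) ^+ 2 * sE <= (11/10 * k2) ^+ 2 * (11/10 * e).
  by rewrite ler_wpM2l ?sqr_ge0.
have h5 : 11/5 * k2 * x <= k2 * (11/10 * x + (11/10)^+2 * k2 * (11/10 * e)) by nra.
have : 11/5 * x <= (11/10 * x + (11/10)^+2 * k2 * (11/10 * e)).
  by rewrite -(ler_pM2l k20); lra.
have := mulr_ge0 (ltW k20) e0; lra.
Qed.

(** By polarization, four times the right side is a difference of two measured squares. [H] cancels
    from the difference [v - u] and is doubled in the sum, so the RIP bounds the form below by a
    multiple of [|H|^2] up to the errors [u] and [v]. *)
Lemma RIP_inner_ge A k delta (H u v : 'M[R]_(n1, n2)) :
  RIP A k delta -> delta <= 1/10 ->
  (\rank (H + v + (H + u))%R <= k)%N -> (\rank (H + v - (H + u))%R <= k)%N ->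
  9/20 * frob H ^+ 2 - (frob u ^+ 2 + frob v ^+ 2)
    <= mxinner (normal_op A (H + v)) (H + u).
Proof.
move=> [/andP[d0 _] rip] hd r1 r2.
have := mxinner_normal_polar A (H + v) (H + u).
have [h1 _] := rip _ r1; have [_ h2] := rip _ r2; move: h1 h2.
have -> : H + v + (H + u) = 2 *: H + (v + u).
  by rewrite scaler_nat mulr2n addrACA.
have -> : H + v - (H + u) = v - u by rewrite opprD addrACA subrr add0r.
move: (sqnorm_opA _ _) (sqnorm_opA _ _) => s2 s1.
have := sqr_ge0 (frob (2 *: H + (v + u))); have := sqr_ge0 (frob (H + (v + u))).
rewrite (sqr_frobD H).
rewrite (sqr_frobD (2 *: H)) frobZ ger0_norm // (sqr_frobB v) !sqr_frobD mxinnerZl.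
have := sqr_ge0 (frob (v - u)); rewrite sqr_frobB.
have := sqr_ge0 (frob (v + u)); rewrite sqr_frobD.
move: (mxinner H _) (mxinner v _) (mxinner (normal_op _ _) _) => a b c.
rewrite exprMn.
have := sqr_ge0 (frob H); have := sqr_ge0 (frob v); have := sqr_ge0 (frob u).
move: (frob H ^+ 2) (frob v ^+ 2) (frob u ^+ 2) => h x y x0 y0 h0 p1 p2 p4 p3 h1 h2 h3.
have e1 : 9/10 * (2 ^+ 2 * h + 2 * (2 * a) + (x + 2 * b + y)) <= s1.
  apply: le_trans h1; rewrite ler_wpM2r //; lra.
have e2 : s2 <= 11/10 * (x - 2 * b + y).
  by apply: le_trans h2 _; rewrite ler_wpM2r //; lra.
lra.
Qed.

End Measurement.

(** Transposing the sensing matrices lets the [Y] gradient reuse the bound proved for the [X]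
    gradient. *)
Lemma RIP_tr n1 n2 m (A : 'I_m -> 'M[R]_(n1, n2)) k delta :
  RIP A k delta -> RIP (fun i => (A i)^T) k delta.
Proof.
move=> [d0 rip]; split=> // M; rewrite -(mxrank_tr M) -(frob_tr M) => /rip.
rewrite /sqnorm_opA /opA.
by under eq_bigr do rewrite -mxinner_tr trmxK.
Qed.

Lemma normal_op_tr n1 n2 m (A : 'I_m -> 'M[R]_(n1, n2)) E :
  normal_op (fun i => (A i)^T) E^T = (normal_op A E)^T.
Proof.
by rewrite /normal_op raddf_sum; apply: eq_bigr => i _; rewrite mxinner_tr;
  apply/matrixP => a b; rewrite !mxE.
Qed.

End Bounds.

(** * One gradient step in aligned coordinates *)

Section Step.
Context {R : realType}.
Implicit Types p q r : nat.

Lemma near_id_frobM p r (W : 'M[R]_r) w (T : 'M[R]_(p, r)) :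
  near_id W w -> frob (T *m W) <= (1 + w) * frob T.
Proof.
move=> /(_ p T); have := frobB_ge (T *m W) T; lra.
Qed.

Lemma sqr_near_id_frobM_le p r (W : 'M[R]_r) w (T : 'M[R]_(p, r)) :
  near_id W w -> 0 <= w -> w <= 1/100 -> frob (T *m W) ^+ 2 <= 11/10 * frob T ^+ 2.
Proof.
move=> hW w0 w1; have := near_id_frobM T hW.
have := frob_ge0 T; have := frob_ge0 (T *m W).
move: (frob (T *m W)) (frob T) => tw t tw0 t0 h.
have h1 : tw <= 101/100 * t by apply: le_trans h _; rewrite ler_wpM2r //; lra.
have : tw ^+ 2 <= (101/100 * t) ^+ 2 by rewrite lerXn2r ?nnegrE ?mulr_ge0 //; lra.
have := sqr_ge0 t; lra.
Qed.

Lemma le_of_sum_sqr (e x y : R) : 0 <= e -> x ^+ 2 + y ^+ 2 <= e ^+ 2 -> x <= e /\ y <= e.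
Proof.
move=> e0 h; have := sqr_ge0 x; have := sqr_ge0 y => h1 h2.
by split; apply: le_of_sqr => //; lra.
Qed.

Lemma linearized_residual_ge n1 n2 r (X dX : 'M[R]_(n1, r)) (Y dY : 'M[R]_(n2, r)) a K :
  0 <= a -> mx_bounds X a K -> mx_bounds Y a K ->
  a ^+ 2 * (frob dX ^+ 2 + frob dY ^+ 2) - frob (X^T *m dX - dY^T *m Y) ^+ 2
    <= frob (dX *m Y^T + X *m dY^T) ^+ 2.
Proof.
move=> a0 hX hY.
have /andP[h1 _] := mx_bounds_trr dX hY.
have /andP[h2 _] := hX _ dY^T; rewrite frob_tr in h2.
have h1' : a ^+ 2 * frob dX ^+ 2 <= frob (dX *m Y^T) ^+ 2.
  by rewrite -exprMn lerXn2r ?nnegrE ?frob_ge0 ?mulr_ge0 ?frob_ge0.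
have h2' : a ^+ 2 * frob dY ^+ 2 <= frob (X *m dY^T) ^+ 2.
  by rewrite -exprMn lerXn2r ?nnegrE ?frob_ge0 ?mulr_ge0 ?frob_ge0.
rewrite sqr_frobB sqr_frobD.
have -> : mxinner (dX *m Y^T) (X *m dY^T) = mxinner (X^T *m dX) (dY^T *m Y).
  by rewrite mxinnerMr trmxK mxinnerC -mulmxA mxinnerMl mxinnerC.
have := sqr_ge0 (frob (X^T *m dX)); have := sqr_ge0 (frob (dY^T *m Y)); lra.
Qed.

Lemma residual_expand n1 n2 r (X dX : 'M[R]_(n1, r)) (Y dY : 'M[R]_(n2, r)) :
  X *m Y^T - (X - dX) *m (Y - dY)^T = dX *m Y^T + X *m dY^T - dX *m dY^T.
Proof.
rewrite linearB /= mulmxBl !mulmxBr.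
move: (X *m Y^T) (X *m dY^T) (dX *m Y^T) (dX *m dY^T) => a b c d.
by apply/matrixP => i j; rewrite !mxE; ring.
Qed.

(** Scalar form of the bound on [N - H] in [gd_step]: [x], [y] are the factor errors and [a], [b]
    the changes made by [W1], [W2]. The hypothesis on [omega * L] trades the upper scale [L] for
    [l]. *)
Lemma perturbation_sqr_le (l L omega a b c d e x y : R) :
  0 < L -> 0 <= omega -> 100 * omega * L <= l -> 0 <= x -> 0 <= y -> 0 <= e ->
  a <= omega * x -> b <= omega * y ->
  c <= 11/10 * L * a -> d <= 11/10 * L * b -> e <= c + d ->
  e ^+ 2 <= l ^+ 2 * (x ^+ 2 + y ^+ 2) / 4000.
Proof.
move=> L0 w0 hw x0 y0 e0 ha hb hc hd he.
have ha' : 11/10 * L * a <= 11/10 * L * (omega * x) by rewrite ler_wpM2l //; lra.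
have hb' : 11/10 * L * b <= 11/10 * L * (omega * y) by rewrite ler_wpM2l //; lra.
have h1 : e <= 11/10 * (omega * L * (x + y)) by lra.
have h2 : omega * L * (x + y) <= l / 100 * (x + y).
  by rewrite ler_wpM2r ?addr_ge0 //; lra.
have l0 : 0 <= l by apply: le_trans hw; rewrite !mulr_ge0 // ltW.
have h3 : e ^+ 2 <= (11/1000 * l * (x + y)) ^+ 2.
  by rewrite lerXn2r ?nnegrE ?mulr_ge0 ?addr_ge0 //; lra.
have h4 : (x + y) ^+ 2 <= 2 * (x ^+ 2 + y ^+ 2).
  by have := sqr_ge0 (x - y); clear; lra.
have h5 : l ^+ 2 * (x + y) ^+ 2 <= l ^+ 2 * (2 * (x ^+ 2 + y ^+ 2)).
  by rewrite ler_wpM2l ?sqr_ge0.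
have : 0 <= l ^+ 2 * (x ^+ 2 + y ^+ 2) by rewrite mulr_ge0 ?addr_ge0 ?sqr_ge0.
clear -h3 h5; lra.
Qed.

(** Bookkeeping for one step: [h], [u], [v], [e] are the squared norms of the linearised residual,
    its two errors and the full residual; [gx], [gy] those of the gradients; [I] is the first-order
    gain. *)
Lemma descent_scalar (k eta l L h u v e gx gy I f g : R) :
  0 < k -> k * L ^+ 2 = eta -> 0 < eta -> eta <= 1/1000 -> 0 < L ^+ 2 -> 0 <= h -> 0 <= v ->
  0 <= l ^+ 2 * f -> v <= l ^+ 2 * f / 400 -> u <= l ^+ 2 * f / 4000 -> e <= 2 * (h + v) ->
  gx <= 3 * L ^+ 2 * e -> gy <= 3 * L ^+ 2 * e ->
  9/20 * h - (u + v) <= I -> (9/10 * l) ^+ 2 * f - g <= h -> 0 <= g ->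
  f - 2 * k * I + k ^+ 2 * (gx + gy) <= (1 - k * l ^+ 2 / 2) * f + k * g.
Proof.
move=> k0 kL eta0 eta1 L2 h0 v0 lf hv hu he hgx hgy hI hH g0.
(* One factor [k] meets the [L ^+ 2] of the gradient bounds and becomes [eta], small enough for the
   first-order gain to dominate. *)
have second : k ^+ 2 * (gx + gy) <= k * (12/1000 * (h + l ^+ 2 * f / 400)).
  rewrite expr2 -mulrA ler_pM2l //.
  apply: le_trans (_ : k * (6 * L ^+ 2 * (2 * (h + v))) <= _).
    rewrite ler_pM2l //; have := ler_wpM2l (ltW L2) he; clear -hgx hgy; lra.
  have -> : k * (6 * L ^+ 2 * (2 * (h + v))) = eta * (12 * (h + v)) by rewrite -kL; ring.
  apply: le_trans (_ : 1/1000 * (12 * (h + v)) <= _); last by clear -hv; lra.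
  by rewrite ler_wpM2r //; clear -h0 v0; lra.
have first : k * (9/20 * h - l ^+ 2 * f / 300) <= k * I.
  by rewrite ler_pM2l //; clear -hI hv hu lf; lra.
have third : k * ((9/10 * l) ^+ 2 * f - g) <= k * h by rewrite ler_pM2l.
have := mulr_ge0 (ltW k0) lf; have := mulr_ge0 (ltW k0) g0.
clear -first second third; lra.
Qed.

(** [W1] and [W2] model the Gram matrix of the alignment and its inverse, up to step-size ratios.
    Expanding the squares, the first-order term is [<G, N>], with [N] close to the linearised
    residual [H] and [G] the normal operator at [H + v]. *)
Lemma gd_step n1 n2 r m (A : 'I_m -> 'M[R]_(n1, n2)) delta
    (Xs X : 'M[R]_(n1, r)) (Ys Y : 'M[R]_(n2, r)) (W1 W2 : 'M[R]_r)
    (l L omega eta : R) (G := normal_op A (X *m Y^T - Xs *m Ys^T))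
    (f := frob (X - Xs) ^+ 2 + frob (Y - Ys) ^+ 2) :
  RIP A (2 * r) delta -> delta <= 1/10 -> 0 < l -> l <= L ->
  mx_bounds Xs l L -> mx_bounds Ys l L -> f <= (l / 10) ^+ 2 ->
  W1^T = W1 -> W2^T = W2 -> near_id W1 omega -> near_id W2 omega ->
  0 <= omega -> 100 * omega * L <= l -> 0 < eta -> eta <= 1/1000 ->
  frob (X - (eta / L ^+ 2) *: (G *m Y *m W1) - Xs) ^+ 2 +
  frob (Y - (eta / L ^+ 2) *: (G^T *m X *m W2) - Ys) ^+ 2 <=
  (1 - eta / 2 * (l ^+ 2 / L ^+ 2)) * f +
  (eta / L ^+ 2) * frob (X^T *m (X - Xs) - (Y - Ys)^T *m Y) ^+ 2.
Proof.
move=> rip hd l0 lL hXs hYs hf W1t W2t hW1 hW2 w0 hw eta0 eta1.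
have L0 : 0 < L by exact: lt_le_trans lL.
have l10 : 0 <= l / 10 by lra.
have [hx hy] := le_of_sum_sqr l10 hf.
have hX0 := mx_bounds_perturb hXs hx; have hY0 := mx_bounds_perturb hYs hy.
have bounds p (Z : 'M[R]_(p, r)) : mx_bounds Z (l - l / 10) (L + l / 10) ->
    mx_bounds Z (9/10 * l) (11/10 * L).
  move=> hZ q T; have /andP[z1 z2] := hZ q T; have := frob_ge0 T => z0.
  apply/andP; split; first by lra.
  by apply: le_trans z2 _; rewrite ler_wpM2r //; lra.
have {hX0} hX := bounds _ _ hX0; have {hY0} hY := bounds _ _ hY0.
set dX := X - Xs in f hf hx *; set dY := Y - Ys in f hf hy *.
set H := dX *m Y^T + X *m dY^T.
pose v := - (dX *m dY^T).
pose N := dX *m W1 *m Y^T + X *m W2 *m dY^T.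
have l9 : 0 <= 9/10 * l by lra.
have := linearized_residual_ge dX dY l9 hX hY; rewrite -/H -/f.
set g2 := frob (_ - _) ^+ 2 => hH.
have EE : X *m Y^T - Xs *m Ys^T = H + v.
by rewrite -[Xs in LHS](subKr X) -[Ys in LHS](subKr Y) residual_expand.
have f0 : 0 <= f by rewrite addr_ge0 ?sqr_ge0.
(* [|v| <= |dX| |dY| <= f / 2], and one factor [f] is at most [(l / 10)^2]. *)
have hv : frob v ^+ 2 <= l ^+ 2 * f / 400.
  have : frob v <= frob dX * frob dY by rewrite frobN -(frob_tr dY) frobM_le.
  have := frob_ge0 v; have := frob_ge0 dX; have := frob_ge0 dY.
  move: hf; rewrite /f; move: (frob v) (frob dX) (frob dY) => vv x y hf y0 x0 v0 hv.
  have h1 : vv ^+ 2 <= (x * y) ^+ 2 by rewrite lerXn2r ?nnegrE ?mulr_ge0 //; lra.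
  have h2 : (x * y) ^+ 2 <= (x ^+ 2 + y ^+ 2) ^+ 2 / 4.
    by have := sqr_ge0 (x ^+ 2 - y ^+ 2); clear; lra.
  have h3 : (x ^+ 2 + y ^+ 2) ^+ 2 <= (x ^+ 2 + y ^+ 2) * (l / 10) ^+ 2.
    by rewrite [leLHS]expr2 ler_wpM2l // addr_ge0 ?sqr_ge0.
  clear -h1 h2 h3; lra.
have hu : frob (N - H) ^+ 2 <= l ^+ 2 * f / 4000.
  have -> : N - H = (dX *m W1 - dX) *m Y^T + X *m (dY *m W2 - dY)^T.
    have -> : (dY *m W2 - dY)^T = W2 *m dY^T - dY^T by rewrite linearB /= trmx_mul W2t.
    by rewrite /N /H [(_ - dX) *m _]mulmxBl mulmxBr mulmxA opprD addrACA.
  have := frobD_le ((dX *m W1 - dX) *m Y^T) (X *m (dY *m W2 - dY)^T).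
  have /andP[_] := mx_bounds_trr (dX *m W1 - dX) hY.
  have /andP[_] := hX _ (dY *m W2 - dY)^T; rewrite frob_tr.
  have := hW1 _ dX; have := hW2 _ dY.
  have := frob_ge0 dX; have := frob_ge0 dY.
  have := frob_ge0 ((dX *m W1 - dX) *m Y^T + X *m (dY *m W2 - dY)^T).
  rewrite /f; move: (frob (_ + _)) (frob (_ *m _)) (frob (_ *m _)).
  move: (frob (_ - dX)) (frob (_ - dY)) (frob dX) (frob dY).
  move=> a b x y uu c d u0 y0 x0 hb ha hd1 hc huu.
  exact: perturbation_sqr_le L0 w0 hw x0 y0 u0 ha hb hc hd1 huu.
have NH : N = H + (N - H) by rewrite addrC subrK.
(* All these matrices factor through the columns of [X] and [Xs], hence rank at most [2 * r]. The
   values [1] and [-1] serve polarization, and [0] gives the residual itself. *)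
have rk (a : R) : (\rank (H + v + a *: N)%R <= 2 * r)%N.
  have -> : H + v + a *: N = X *m (Y^T + a *: (W1 *m Y^T) + a *: (W2 *m dY^T))
            + Xs *m (- Ys^T - a *: (W1 *m Y^T)).
    rewrite -EE /N /dX !(mulmxBl, mulmxDr, mulmxN, scalerDr, scalerBr, mulmxBr, mulmxDl).
    rewrite -!scalemxAr !mulmxA.
    move: (X *m Y^T) (Xs *m Ys^T) (X *m W1 *m Y^T) (Xs *m W1 *m Y^T) (X *m W2 *m dY^T).
    by move=> a1 a2 a3 a4 a5; apply/matrixP => i j; rewrite !mxE; ring.
  exact: mxrank_sumM_le.
have hI : 9/20 * frob H ^+ 2 - (frob (N - H) ^+ 2 + frob v ^+ 2) <= mxinner G N.
  rewrite /G EE [in mxinner _ N]NH; apply: (RIP_inner_ge rip) => //; rewrite -NH.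
    by have := rk 1; rewrite scale1r.
  by have := rk (-1); rewrite scaleN1r.
have rE : (\rank (X *m Y^T - Xs *m Ys^T)%R <= 2 * r)%N.
  by have := rk 0; rewrite scale0r addr0 EE.
have r2 : (r <= 2 * r)%N by rewrite leq_pmull.
have K0 : 0 < 11/10 * L by clear -L0; lra.
have e2 : frob (X *m Y^T - Xs *m Ys^T) ^+ 2 <= 2 * (frob H ^+ 2 + frob v ^+ 2).
  rewrite EE; have := sqr_ge0 (frob (H - v)); rewrite (sqr_frobB H v) (sqr_frobD H v); clear; lra.
have w1 : omega <= 1/100.
  by rewrite -(ler_pM2r L0); clear -hw lL; lra.
have hGY : frob (G *m Y *m W1) ^+ 2 <= 3 * L ^+ 2 * frob (X *m Y^T - Xs *m Ys^T) ^+ 2.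
  apply: le_trans (sqr_near_id_frobM_le _ hW1 w0 w1) _.
  have := frob_normalM_le rip hd r2 rE K0 (fun q T => proj2 (andP (mx_bounds_trr T hY))).
  have := mulr_ge0 (sqr_ge0 L) (sqr_ge0 (frob (X *m Y^T - Xs *m Ys^T))).
  by rewrite -/G; clear; lra.
have hGX : frob (G^T *m X *m W2) ^+ 2 <= 3 * L ^+ 2 * frob (X *m Y^T - Xs *m Ys^T) ^+ 2.
  apply: le_trans (sqr_near_id_frobM_le _ hW2 w0 w1) _.
  have := frob_normalM_le (RIP_tr rip) hd r2 _ K0
    (fun q T => proj2 (andP (mx_bounds_trr T hX))).
  move=> /(_ (X *m Y^T - Xs *m Ys^T)^T); rewrite mxrank_tr => /(_ rE).
  rewrite normal_op_tr frob_tr.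
  have := mulr_ge0 (sqr_ge0 L) (sqr_ge0 (frob (X *m Y^T - Xs *m Ys^T))).
  by rewrite -/G; clear; lra.
set k := eta / L ^+ 2.
(* Symmetry of [W1] and [W2] moves them from the gradients onto [dX] and [dY]. *)
have cross : mxinner dX (G *m Y *m W1) + mxinner dY (G^T *m X *m W2) = mxinner G N.
  rewrite mxinnerDr; congr (_ + _).
    by rewrite mxinnerC 2!mxinnerMr W1t.
  rewrite mxinnerC 2!mxinnerMr W2t -mxinner_tr trmxK trmx_mul trmx_mul W2t trmxK.
  by rewrite mulmxA.
have -> : X - k *: (G *m Y *m W1) - Xs = dX - k *: (G *m Y *m W1) by rewrite addrAC.
have -> : Y - k *: (G^T *m X *m W2) - Ys = dY - k *: (G^T *m X *m W2) by rewrite addrAC.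
have k0 : 0 < k by rewrite divr_gt0 ?exprn_gt0.
have kL : k * L ^+ 2 = eta by rewrite divfK // expf_neq0 // gt_eqF.
rewrite (sqr_frobB dX (k *: (G *m Y *m W1))) (sqr_frobB dY (k *: (G^T *m X *m W2))).
rewrite !frobZ !mxinnerZr gtr0_norm // ![(k * _) ^+ 2]exprMn.
have -> : eta / 2 * (l ^+ 2 / L ^+ 2) = k * l ^+ 2 / 2 by rewrite /k; ring.
have L2 : 0 < L ^+ 2 by rewrite exprn_gt0.
have h0 := sqr_ge0 (frob H).
have lf : 0 <= l ^+ 2 * f by rewrite mulr_ge0 ?sqr_ge0.
have fE : f = frob dX ^+ 2 + frob dY ^+ 2 by [].
rewrite -cross in hI.
have := descent_scalar k0 kL eta0 eta1 L2 h0 (sqr_ge0 (frob v)) lf hv hu e2 hGY hGX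
  hI hH (sqr_ge0 _).
by move: fE; move: (f) => f'; clear; lra.
Qed.

End Step.

(** * Approximate optimality and drift of the alignment *)

Section Gauge.
Context {R : realType}.
Implicit Types n p q r : nat.

(** A kernel matrix [M] satisfies [M = - M B], so [|M| <= |M| |B|] forces [M = 0]. *)
Lemma unitmx_add1 r (B : 'M[R]_r) : frob B < 1 -> 1%:M + B \in unitmx.
Proof.
move=> hB; rewrite -row_free_unit -kermx_eq0.
have := mulmx_ker (1%:M + B); move: (kermx _) => M.
rewrite mulmxDr mulmx1 => /eqP; rewrite addr_eq0 => /eqP hM.
apply/eqP/frob0_eq0/eqP; rewrite eq_le frob_ge0 andbT.
have := frobM_le M B; rewrite -[frob (M *m B)]frobN -hM.
have := frob_ge0 M; nra.
Qed.

(** First-order Neumann expansion of the inverse, from the identity [K + B = - K B]. *)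
Lemma invmx_add1_near r (B : 'M[R]_r) (K := invmx (1%:M + B) - 1%:M) :
  frob B <= 1/2 -> frob K <= 2 * frob B /\ frob (K + B) <= 2 * frob B ^+ 2.
Proof.
move=> hB; have uB : 1%:M + B \in unitmx by apply: unitmx_add1; lra.
have KB : K + B = - (K *m B).
  apply/eqP; rewrite -addr_eq0; apply/eqP.
  have := mulVmx uB; rewrite -[invmx _](subrK 1%:M) -/K.
  rewrite mulmxDl mulmxDr mulmx1 mul1mx => /eqP; rewrite -subr_eq0 => /eqP <-.
  by rewrite [1%:M + B]addrC addrA addrK addrAC.
have h1 : frob (K + B) <= frob K * frob B by rewrite KB frobN frobM_le.
have h2 := frobB_ge K (- B); rewrite opprK frobN in h2.
have k0 := frob_ge0 K; have b0 := frob_ge0 B.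
have h3 : frob K <= 2 * frob B by nra.
by split=> //; rewrite expr2; nra.
Qed.

(** Moving the alignment from [1] to [1 - s g] changes the objective by [- 2 s |g|^2] to first
    order. Near-minimality allows a decrease of at most [tau], which bounds [g] once the
    second-order terms are controlled. *)
Lemma gauge_gradient_le n1 n2 r (Xs X : 'M[R]_(n1, r)) (Ys Y : 'M[R]_(n2, r))
    (L d2 tau : R) (g := X^T *m (X - Xs) - (Y - Ys)^T *m Y) :
  0 < L ->
  (forall q (T : 'M[R]_(r, q)), frob (X *m T) <= 11/10 * L * frob T) ->
  (forall q (T : 'M[R]_(r, q)), frob (Y *m T) <= 11/10 * L * frob T) ->
  frob (X - Xs) <= L / 10 -> frob (Y - Ys) <= L / 10 ->
  frob (X^T *m (X - Xs)) <= 11/10 * L * (L / 10) ->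
  frob (Y^T *m (Y - Ys)) <= 11/10 * L * (L / 10) ->
  (forall Q, Q \in unitmx ->
     d2 <= frob (X *m Q - Xs) ^+ 2 + frob (Y *m (invmx Q)^T - Ys) ^+ 2) ->
  frob (X - Xs) ^+ 2 + frob (Y - Ys) ^+ 2 <= d2 + tau ->
  frob g ^+ 2 <= 10 * L ^+ 2 * tau.
Proof.
move=> L0 hX hY hdX hdY hgX hgY hmin hf.
set dX := X - Xs in g hdX hgX hf *; set dY := Y - Ys in g hdY hgY hf *.
have L2 : 0 < L ^+ 2 by rewrite exprn_gt0.
(* With this [s], the second-order terms, below [7 L^2 |B|^2], cost less than [s |g|^2], so a net
   decrease of at least [s |g|^2] remains. *)
pose s := (10 * L ^+ 2)^-1.
have s0 : 0 < s by rewrite invr_gt0; lra.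
have sL : s * L ^+ 2 = 1/10 by rewrite /s; field; rewrite gt_eqF.
have hg : frob g <= 22/100 * L ^+ 2.
  apply: le_trans (frobB_le _ _) _.
  have -> : frob (dY^T *m Y) = frob (Y^T *m dY) by rewrite -frob_tr trmx_mul trmxK.
  clear -hgX hgY; lra.
have g0 := frob_ge0 g.
pose B := - (s *: g).
have b0 := frob_ge0 B.
have Bs : frob B = s * frob g by rewrite frobN frobZ gtr0_norm.
have hb : frob B <= 1/2.
  rewrite Bs; apply: le_trans (_ : s * (22/100 * L ^+ 2) <= _); last by clear -sL; lra.
  by rewrite ler_pM2l.
have uB : 1%:M + B \in unitmx by apply: unitmx_add1; clear -hb; lra.
have [hK hKB] := invmx_add1_near hb; have := hmin _ uB.
set K := invmx (1%:M + B) - 1%:M in hK hKB *.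
have -> : X *m (1%:M + B) - Xs = dX + X *m B by rewrite mulmxDr mulmx1 addrAC.
have -> : Y *m (invmx (1%:M + B))^T - Ys = dY + Y *m K^T.
  by rewrite /K linearB /= trmx1 mulmxBr mulmx1 [RHS]addrC addrA subrK.
rewrite (sqr_frobD dX) (sqr_frobD dY).
have i1 : mxinner dX (X *m B) + mxinner dY (Y *m K^T)
    = - s * frob g ^+ 2 + mxinner dY (Y *m (K + B)^T).
  have -> : mxinner dX (X *m B) = mxinner (X^T *m dX) B.
    by rewrite mxinnerC mxinnerMl mxinnerC.
  have -> : Y *m K^T = Y *m (K + B)^T - Y *m B^T.
    by rewrite -mulmxBr; congr (_ *m _); apply/matrixP => i j; rewrite !mxE addrK.
  have e1 : mxinner dY (Y *m B^T) = mxinner (dY^T *m Y) B.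
    by rewrite mxinnerC mxinnerMl -mxinner_tr trmxK trmx_mul trmxK mxinnerC.
  have e2 : mxinner g B = - s * frob g ^+ 2.
    by rewrite sqr_frob mxinnerNr mxinnerZr mulNr.
  have e3 : mxinner g B = mxinner (X^T *m dX) B - mxinner (dY^T *m Y) B.
    by rewrite /g mxinnerDl mxinnerNl.
  by rewrite -e2 e3 (mxinnerDr dY) (mxinnerNr dY) e1; ring.
have i2 : mxinner dY (Y *m (K + B)^T) <= 22/100 * L ^+ 2 * frob B ^+ 2.
  have h := hY _ (K + B)^T; rewrite frob_tr in h.
  apply: le_trans (mxinner_le _ _) _.
  apply: le_trans (_ : L / 10 * (11/10 * L * (2 * frob B ^+ 2)) <= _); last by clear; lra.
  apply: ler_pM; rewrite ?frob_ge0 //; apply: le_trans h _.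
  by rewrite ler_wpM2l //; clear -L0; lra.
have i3 : frob (X *m B) ^+ 2 <= 121/100 * L ^+ 2 * frob B ^+ 2.
  have -> : 121/100 * L ^+ 2 * frob B ^+ 2 = (11/10 * L * frob B) ^+ 2 by field.
  by apply: lerXn2r; rewrite ?hX // nnegrE ?frob_ge0 // mulr_ge0 ?frob_ge0 //; clear -L0; lra.
have i4 : frob (Y *m K^T) ^+ 2 <= 484/100 * L ^+ 2 * frob B ^+ 2.
  have -> : 484/100 * L ^+ 2 * frob B ^+ 2 = (22/10 * L * frob B) ^+ 2 by field.
  have h := hY _ K^T; rewrite frob_tr in h.
  apply: lerXn2r; rewrite ?nnegrE ?frob_ge0 //.
    by rewrite mulr_ge0 ?frob_ge0 //; clear -L0; lra.
  apply: le_trans h _.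
  have : 11/10 * L * frob K <= 11/10 * L * (2 * frob B) by rewrite ler_wpM2l //; clear -L0; lra.
  clear; lra.
have e3 : L ^+ 2 * frob B ^+ 2 = 1/10 * (s * frob g ^+ 2).
  by rewrite Bs -sL; ring.
move=> hm.
have sg0 : 0 <= s * frob g ^+ 2 by rewrite mulr_ge0 ?sqr_ge0 // ltW.
have : s * frob g ^+ 2 <= tau by clear -hm hf i1 i2 i3 i4 e3 sg0; lra.
rewrite -(ler_pM2l L2) mulrA [L ^+ 2 * s]mulrC sL; clear; lra.
Qed.

(** Expanding [(1 + B^T) W (1 + B) - 1] around [W - 1] leaves six further terms, each of norm at
    most [b]. *)
Lemma frob_gram_drift r (P0 B : 'M[R]_r) w b :
  frob (P0^T *m P0 - 1%:M) <= w -> w <= 1 -> frob B <= b -> b <= 1 ->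
  frob ((P0 *m (1%:M + B))^T *m (P0 *m (1%:M + B)) - 1%:M) <= w + 6 * b.
Proof.
move: (erefl (P0^T *m P0)); move: {2 3}(P0^T *m P0) => W WE hW w1 hB b1.
have -> : (P0 *m (1%:M + B))^T *m (P0 *m (1%:M + B)) - 1%:M
   = (W - 1%:M) + (W - 1%:M) *m B + B^T *m (W - 1%:M) + B^T *m (W - 1%:M) *m B
     + B + B^T + B^T *m B.
  have -> : (P0 *m (1%:M + B))^T *m (P0 *m (1%:M + B)) = (1%:M + B^T) *m W *m (1%:M + B).
    by rewrite trmx_mul -WE !mulmxA; congr (_ *m _ *m _ *m _); rewrite linearD /= trmx1.
  rewrite !(mulmxBr, mulmxBl, mulmxDl, mulmxDr, mulmxN, mulNmx, mulmx1, mul1mx).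
  move: (W *m B) (B^T *m W) (B^T *m W *m B) (B^T *m B) => c1 c2 c3 c4.
  by apply/matrixP => i j; rewrite !mxE; ring.
have w0 : 0 <= frob (W - 1%:M) := frob_ge0 _.
have b0 : 0 <= frob B := frob_ge0 _.
have bt := frob_tr B.
have m1 := frobM_le (W - 1%:M) B.
have m2 := frobM_le B^T (W - 1%:M).
have m3 := frobM_le (B^T *m (W - 1%:M)) B.
have m4 := frobM_le B^T B.
rewrite bt in m2 m4.
do 6 (apply: le_trans (frobD_le _ _) _; rewrite -lerBrDr).
rewrite bt.
have n1 : frob (W - 1%:M) * frob B <= b by nra.
have n2 : frob B * frob B <= b by nra.
have n3 : frob (B^T *m (W - 1%:M)) * frob B <= b by nra.
lra.
Qed.

(** Write [P = P0 (1 + B)]. Both aligned points lie within [e] of [Xs], so [|X P0 B| <= 2 e], and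
    the lower bound [a] turns this into [|B| <= 2 e / a]. *)
Lemma aligned_drift n r (Xs X : 'M[R]_(n, r)) (P0 P : 'M[R]_r) a K e w :
  P0 \in unitmx -> mx_bounds (X *m P0) a K -> 0 < a -> 2 * e <= a ->
  frob (X *m P0 - Xs) <= e -> frob (X *m P - Xs) <= e ->
  frob (P0^T *m P0 - 1%:M) <= w -> w <= 1 ->
  frob (P^T *m P - 1%:M) <= w + 12 * e / a.
Proof.
move=> u0 hX a0 ea h0 h1 hw w1.
pose B := invmx P0 *m P - 1%:M.
have PB : P = P0 *m (1%:M + B).
  by rewrite /B addrC subrK mulmxA mulmxV // mul1mx.
clearbody B.
have hB : frob B <= 2 * e / a.
  rewrite ler_pdivlMr // mulrC; have /andP[h _] := hX _ B; apply: le_trans h _.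
  have -> : X *m P0 *m B = (X *m P - Xs) - (X *m P0 - Xs).
    by rewrite opprB addrA subrK PB mulmxA mulmxDr mulmx1 addrAC subrr add0r.
  by apply: le_trans (frobB_le _ _) _; lra.
have -> : 12 * e / a = 6 * (2 * e / a) by ring.
by rewrite PB; apply: frob_gram_drift => //; rewrite ler_pdivrMr // mul1r.
Qed.

Lemma near_id_of_frob r (W : 'M[R]_r) a w e :
  0 <= a -> frob (W - 1%:M) <= w -> `|a - 1| <= e -> near_id (a *: W) (a * w + e).
Proof.
move=> a0 hW ha p T.
have -> : T *m (a *: W) - T = a *: (T *m (W - 1%:M)) + (a - 1) *: T.
  by rewrite -scalemxAr mulmxBr mulmx1 scalerBr scalerBl scale1r addrA subrK.
apply: le_trans (frobD_le _ _) _; rewrite !frobZ mulrDl (ger0_norm a0) -mulrA.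
have h := frobM_le T (W - 1%:M); have t0 := frob_ge0 T.
apply: lerD; last by rewrite ler_wpM2r.
rewrite ler_wpM2l // mulrC; apply: le_trans h _; rewrite ler_wpM2l //.
Qed.

(** [V] is the inverse of [W], so [V - 1 = - (V - 1)(W - 1) - (W - 1)]; the product is absorbed
    because [w <= 1/2]. *)
Lemma frob_inv_gram_near r (P : 'M[R]_r) w :
  P \in unitmx -> frob (P^T *m P - 1%:M) <= w -> w <= 1/2 ->
  frob (invmx P *m (invmx P)^T - 1%:M) <= 2 * w.
Proof.
move=> uP hw w1; set W := P^T *m P in hw; set V := _ *m (invmx P)^T.
have VW : V *m W = 1%:M.
  rewrite /V /W -mulmxA [(invmx P)^T *m _]mulmxA -trmx_mul mulmxV // trmx1 mul1mx.
  exact: mulVmx.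
have e : V - 1%:M = - ((V - 1%:M) *m (W - 1%:M)) - (W - 1%:M).
  rewrite !(mulmxBl, mulmxBr) VW !(mulmx1, mul1mx).
  by apply/matrixP => i j; rewrite !mxE; ring.
have h : frob (V - 1%:M) <= frob (V - 1%:M) * frob (W - 1%:M) + frob (W - 1%:M).
  rewrite {1}e; apply: le_trans (frobB_le _ _) _.
  by rewrite frobN lerD2r frobM_le.
have := frob_ge0 (V - 1%:M); have := frob_ge0 (W - 1%:M); nra.
Qed.

Lemma vnorm_frob n (v : 'cV[R]_n) : vnorm v = frob v.
Proof. by rewrite /vnorm /frob; congr Num.sqrt; apply: eq_bigr => i _; rewrite big_ord1. Qed.

(** An orthogonal [Q] preserves vector norms, so [X] may be compared with [Xs] through [X Q]. The
    lower bound tests [X] on [Q v], where [v] is a top singular direction of [Xs]. *)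
Lemma specnorm_near n r (Xs X : 'M[R]_(n, r)) (Q : 'M[R]_r) (v : 'cV[R]_r) l L e :
  Q^T *m Q = 1%:M -> mx_bounds Xs l L -> frob v = 1 -> frob (Xs *m v) = L ->
  frob (X *m Q - Xs) <= e -> L - e <= specnorm X <= L + e.
Proof.
move=> QQ hXs v1 vL he.
have QQ' : Q *m Q^T = 1%:M by rewrite mulmx1C.
have iso (A : 'M[R]_r) (u : 'cV[R]_r) : A^T *m A = 1%:M -> frob (A *m u) = frob u.
  by move=> AA; apply: frob_eq; rewrite mxinnerMl mulmxA AA mul1mx.
have ub : ubound [set x | exists u : 'cV[R]_r, vnorm u = 1 /\ x = vnorm (X *m u)]%classic (L + e).
  move=> x [u [u1 ->]]; rewrite vnorm_frob in u1; rewrite vnorm_frob.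
  have /andP[_] := mx_bounds_perturb hXs he (Q^T *m u).
  by rewrite -mulmxA [Q *m _]mulmxA QQ' mul1mx iso ?trmxK // u1 mulr1.
have mem : [set x | exists u : 'cV[R]_r, vnorm u = 1 /\ x = vnorm (X *m u)]%classic
    (frob (X *m (Q *m v))).
  by exists (Q *m v); rewrite !vnorm_frob iso.
apply/andP; split; last by apply: ge_sup ub; exists (frob (X *m (Q *m v))).
apply: le_trans (ub_le_sup _ mem); last by exists (L + e).
rewrite mulmxA; have -> : X *m Q *m v = Xs *m v + (X *m Q - Xs) *m v.
  by rewrite mulmxBl addrC subrK.
have := frobB_ge (Xs *m v) (- ((X *m Q - Xs) *m v)); rewrite opprK frobN vL.
by have := frobM_le (X *m Q - Xs) v; rewrite v1; lra.
Qed.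

End Gauge.

(** * The alignment distance and its near-minimisers *)

Section Dist.
Context {R : realType}.
Context {n1 n2 r : nat}.
Implicit Types (X Xs : 'M[R]_(n1, r)) (Y Ys : 'M[R]_(n2, r)) (P Q : 'M[R]_r).

Definition align_sq X Xs Y Ys P :=
  frob (X *m P - Xs) ^+ 2 + frob (Y *m (invmx P)^T - Ys) ^+ 2.

Lemma align_sq_ge0 X Xs Y Ys P : 0 <= align_sq X Xs Y Ys P.
Proof. by rewrite addr_ge0 ?sqr_ge0. Qed.

Lemma dist_has_inf X Xs Y Ys :
  has_inf [set x | exists P, P \in unitmx /\ x = Num.sqrt (align_sq X Xs Y Ys P)]%classic.
Proof.
split; first by exists (Num.sqrt (align_sq X Xs Y Ys 1%:M)), 1%:M; rewrite unitmx1.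
by exists 0 => x [P [_ ->]]; exact: sqrtr_ge0.
Qed.

Lemma dist_ge0 X Xs Y Ys : 0 <= dist X Xs Y Ys.
Proof.
apply: lb_le_inf; first by have [] := dist_has_inf X Xs Y Ys.
by move=> x [P [_ ->]]; exact: sqrtr_ge0.
Qed.

Lemma dist_sqr_le X Xs Y Ys P :
  P \in unitmx -> dist X Xs Y Ys ^+ 2 <= align_sq X Xs Y Ys P.
Proof.
move=> uP; rewrite -[leRHS]sqr_sqrtr ?align_sq_ge0 //.
rewrite lerXn2r ?nnegrE ?dist_ge0 ?sqrtr_ge0 //.
by apply: ge_inf; [have [] := dist_has_inf X Xs Y Ys | exists P].
Qed.

Lemma dist_near_min X Xs Y Ys tau : 0 < tau ->
  exists2 P, P \in unitmx & align_sq X Xs Y Ys P <= dist X Xs Y Ys ^+ 2 + tau.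
Proof.
move=> tau0; set d := dist X Xs Y Ys.
have d0 : 0 <= d := dist_ge0 _ _ _ _.
(* This slack in the distance becomes exactly [tau] after squaring. *)
have e0 : 0 < Num.sqrt (d ^+ 2 + tau) - d.
  by rewrite subr_gt0 -[ltLHS](ger0_norm d0) -sqrtr_sqr ltr_sqrt ?ltrDl //;
    have := sqr_ge0 d; lra.
have [x [P [uP ->]]] := inf_adherent e0 (dist_has_inf X Xs Y Ys).
rewrite -/(dist X Xs Y Ys) -/d addrC subrK => h; exists P => //.
rewrite -[leLHS]sqr_sqrtr ?align_sq_ge0 // -[leRHS]sqr_sqrtr; last first.
  by have := sqr_ge0 d; lra.
by rewrite lerXn2r ?nnegrE ?sqrtr_ge0 // ltW.
Qed.

End Dist.

(** * Contraction along the iteration *)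

Section Descent.
Context {R : realType}.

Lemma invmxM_tr r (P Q : 'M[R]_r) : P \in unitmx -> Q \in unitmx ->
  (invmx (P *m Q))^T = (invmx P)^T *m (invmx Q)^T.
Proof.
move=> uP uQ; rewrite -trmx_mul; congr (_^T).
have uPQ : P *m Q \in unitmx by rewrite unitmx_mul uP.
rewrite -[RHS](mulmxK uPQ) -[invmx Q *m _ *m _]mulmxA [invmx P *m _]mulmxA.
by rewrite mulVmx // mul1mx mulVmx // mul1mx.
Qed.

(** Aligned coordinates leave the product [X Y^T] unchanged and turn the step into that of
    [gd_step], with [W1 = a1 P^T P] and [W2 = a2 (P^T P)^-1]. Here [a1], [a2] are the ratios of the
    actual step sizes to [eta / L ^+ 2]. *)
Lemma gd_align_step n1 n2 r m (A : 'I_m -> 'M[R]_(n1, n2)) delta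
    (Xs : 'M[R]_(n1, r)) (Ys : 'M[R]_(n2, r)) (l L eta : R)
    (X : 'M[R]_(n1, r)) (Y : 'M[R]_(n2, r)) P a1 a2 e w tau
    (G := normal_op A (X *m Y^T - Xs *m Ys^T)) :
  RIP A (2 * r) delta -> delta <= 1/10 -> 0 < l -> l <= L ->
  mx_bounds Xs l L -> mx_bounds Ys l L -> 0 < eta -> eta <= 1/1000 ->
  P \in unitmx -> align_sq X Xs Y Ys P <= (l / 10) ^+ 2 ->
  align_sq X Xs Y Ys P <= dist X Xs Y Ys ^+ 2 + tau ->
  frob (P^T *m P - 1%:M) <= w -> w <= 1/2 ->
  0 <= a1 <= 11/10 -> 0 <= a2 <= 11/10 -> `|a1 - 1| <= e -> `|a2 - 1| <= e ->
  100 * (22/10 * w + e) * L <= l ->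
  align_sq (X - (eta / L ^+ 2 * a1) *: (G *m Y)) Xs
           (Y - (eta / L ^+ 2 * a2) *: (G^T *m X)) Ys P
  <= (1 - eta / 2 * (l ^+ 2 / L ^+ 2)) * align_sq X Xs Y Ys P + 10 * eta * tau.
Proof.
move=> rip hdelta l0 lL hXs hYs eta0 eta1 uP hl hmin hw w1.
move=> /andP[a10 a11] /andP[a20 a21] ha1 ha2 hom.
have L0 : 0 < L by exact: lt_le_trans lL.
have w0 : 0 <= w by apply: le_trans hw; exact: frob_ge0.
have e0 : 0 <= e by apply: le_trans ha1.
pose Xa := X *m P; pose Ya := Y *m (invmx P)^T.
have XaYa : Xa *m Ya^T = X *m Y^T.
  by rewrite /Xa /Ya trmx_mul trmxK !mulmxA mulmxK.
have YaP : Ya *m P^T = Y.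
  by rewrite /Ya -mulmxA -trmx_mul mulmxV // trmx1 mulmx1.
have XaP : Xa *m invmx P = X by rewrite /Xa mulmxK.
pose W1 := a1 *: (P^T *m P); pose W2 := a2 *: (invmx P *m (invmx P)^T).
have mono W v : near_id (r := r) W v -> v <= 22/10 * w + e -> near_id (R := R) W (22/10 * w + e).
  by move=> h hv p T; apply: le_trans (h p T) _; rewrite ler_wpM2r ?frob_ge0.
have hW1 : near_id W1 (22/10 * w + e).
  apply: mono (near_id_of_frob a10 hw ha1) _.
  by have : a1 * w <= 11/10 * w by [rewrite ler_wpM2r]; lra.
have hW2 : near_id W2 (22/10 * w + e).
  apply: mono (near_id_of_frob a20 (frob_inv_gram_near uP hw w1) ha2) _.
  have : a2 * (2 * w) <= 11/10 * (2 * w) by rewrite ler_wpM2r // mulr_ge0.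
  lra.
have W1t : W1^T = W1 by rewrite /W1 linearZ /= trmx_mul trmxK.
have W2t : W2^T = W2 by rewrite /W2 linearZ /= trmx_mul trmxK.
have om0 : 0 <= 22/10 * w + e by lra.
have := gd_step rip hdelta l0 lL hXs hYs (X := Xa) (Y := Ya) hl W1t W2t hW1 hW2 om0 hom eta0 eta1.
rewrite XaYa -/G.
have -> : G *m Ya *m W1 = a1 *: (G *m Y *m P).
  by rewrite /W1 -scalemxAr (mulmxA _ P^T P) -(mulmxA G Ya P^T) YaP.
have -> : G^T *m Xa *m W2 = a2 *: (G^T *m X *m (invmx P)^T).
  by rewrite /W2 -scalemxAr (mulmxA _ (invmx P) (invmx P)^T) -(mulmxA G^T Xa (invmx P)) XaP.
move=> hstep.
have -> : align_sq (X - (eta / L ^+ 2 * a1) *: (G *m Y)) Xs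
     (Y - (eta / L ^+ 2 * a2) *: (G^T *m X)) Ys P =
   frob (Xa - (eta / L ^+ 2) *: (a1 *: (G *m Y *m P)) - Xs) ^+ 2 +
   frob (Ya - (eta / L ^+ 2) *: (a2 *: (G^T *m X *m (invmx P)^T)) - Ys) ^+ 2.
  by rewrite /align_sq !mulmxBl -!scalemxAl !scalerA.
apply: le_trans hstep _; rewrite lerD2l.
have l10 : 0 <= l / 10 by lra.
have [hx hy] := le_of_sum_sqr l10 hl.
have boundX := mx_bounds_perturb hXs hx; have boundY := mx_bounds_perturb hYs hy.
have up p (Z : 'M[R]_(p, r)) : mx_bounds Z (l - l / 10) (L + l / 10) ->
    mx_bounds Z 0 (11/10 * L).
  move=> hZ q T; have /andP[z1 z2] := hZ q T; have := frob_ge0 T => z0.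
  rewrite mul0r frob_ge0; apply: le_trans z2 _; rewrite ler_wpM2r //; clear -lL; lra.
have {}boundX := up _ _ boundX; have {}boundY := up _ _ boundY.
have K0 : 0 <= 11/10 * L by clear -L0; lra.
have hx' : frob (Xa - Xs) <= L / 10 by apply: le_trans hx _; clear -lL; lra.
have hy' : frob (Ya - Ys) <= L / 10 by apply: le_trans hy _; clear -lL; lra.
have hg : frob (Xa^T *m (Xa - Xs) - (Ya - Ys)^T *m Ya) ^+ 2 <= 10 * L ^+ 2 * tau.
  apply: (@gauge_gradient_le _ _ _ _ _ _ _ _ _ (dist X Xs Y Ys ^+ 2)) => //.
  - by move=> q T; have /andP[] := boundX q T.
  - by move=> q T; have /andP[] := boundY q T.
  - by apply: le_trans (mx_bounds_trl _ K0 boundX) _; rewrite ler_wpM2l.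
  - by apply: le_trans (mx_bounds_trl _ K0 boundY) _; rewrite ler_wpM2l.
  (* Aligning [(Xa, Ya)] by [Q] amounts to aligning [(X, Y)] by [P Q], so [dist] is still a lower
     bound. *)
  move=> Q uQ; rewrite /Xa /Ya -!mulmxA -invmxM_tr //.
  by apply: dist_sqr_le; rewrite unitmx_mul uP.
have k0 : 0 <= eta / L ^+ 2 by rewrite divr_ge0 ?sqr_ge0 // ltW.
apply: le_trans (ler_wpM2l k0 hg) _.
rewrite le_eqVlt; apply/orP; left; apply/eqP; field.
by rewrite gt_eqF.
Qed.

Lemma le_of_small_slack (x y tau0 : R) : 0 < tau0 ->
  (forall tau, 0 < tau -> tau <= tau0 -> x <= y + 2 * tau) -> x <= y.
Proof.
move=> t0 h; rewrite leNgt; apply/negP => hyx.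
pose t := Num.min tau0 ((x - y) / 4).
have tp : 0 < t by rewrite lt_min t0 /=; lra.
have tle : t <= tau0 by rewrite ge_min lexx.
have t2 : t <= (x - y) / 4 by rewrite ge_min lexx orbT.
have := h t tp tle; lra.
Qed.

(* [c] bounds the accumulated drift of [P^T P]: step [t] contributes at most
[30 q^t D / l], and [1 - q = eta l^2 / (50 L^2)]. *)
Lemma gd_dist_contract n1 n2 r m (A : 'I_m -> 'M[R]_(n1, n2)) delta
    (Xs : 'M[R]_(n1, r)) (Ys : 'M[R]_(n2, r)) (l L eta a1 a2 e D : R)
    (X : nat -> 'M[R]_(n1, r)) (Y : nat -> 'M[R]_(n2, r)) (Q : 'M[R]_r)
    (G := fun t => normal_op A (X t *m (Y t)^T - Xs *m Ys^T))
    (c := 1500 * D * L ^+ 2 / (eta * l ^+ 3))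
    (q := 1 - eta / 50 * (l ^+ 2 / L ^+ 2)) :
  RIP A (2 * r) delta -> delta <= 1/10 -> 0 < l -> l <= L ->
  mx_bounds Xs l L -> mx_bounds Ys l L -> 0 < eta -> eta <= 1/1000 ->
  (forall t, X t.+1 = X t - (eta / L ^+ 2 * a1) *: (G t *m Y t)) ->
  (forall t, Y t.+1 = Y t - (eta / L ^+ 2 * a2) *: ((G t)^T *m X t)) ->
  0 <= a1 <= 11/10 -> 0 <= a2 <= 11/10 -> `|a1 - 1| <= e -> `|a2 - 1| <= e ->
  0 < D -> D <= l / 100 -> 100 * (22/10 * c + e) * L <= l ->
  orthogonal_mx Q -> align_sq (X 0) Xs (Y 0) Ys Q <= D ^+ 2 ->
  forall t, dist (X t) Xs (Y t) Ys <= q ^+ t * dist (X 0) Xs (Y 0) Ys.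
Proof.
move=> rip hdelta l0 lL hXs hYs eta0 eta1 hX hY ha1 ha2 he1 he2 D0 Dl hc oQ hQ.
have L0 : 0 < L by exact: lt_le_trans lL.
(* Opaque copies: linear arithmetic would otherwise try to unfold the infima. *)
have [d dE] : exists d, forall t, d t = dist (X t) Xs (Y t) Ys by eexists.
have [f fE] : exists f, forall t P, f t P = align_sq (X t) Xs (Y t) Ys P by eexists.
have d0D : d 0 <= D.
  apply: le_of_sqr; first exact: ltW.
  rewrite dE; apply: le_trans hQ; apply: dist_sqr_le.
  by have [] := mulmx1_unit oQ.
rewrite -fE in hQ.
have c0 : 0 < c by rewrite divr_gt0 ?mulr_gt0 ?exprn_gt0.
have cu0 : c * (eta / 50 * (l ^+ 2 / L ^+ 2)) = 30 * D / l.
  by rewrite /c; field; rewrite !gt_eqF.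
clearbody c.
have [u uE0] : exists u, u = eta / 50 * (l ^+ 2 / L ^+ 2) by eexists.
have qE : q = 1 - u by rewrite uE0.
have cu : c * u = 30 * D / l by rewrite uE0.
have uE : eta / 2 * (l ^+ 2 / L ^+ 2) = 25 * u by rewrite uE0; field; rewrite gt_eqF.
have e0 : 0 <= e by apply: le_trans he1.
have u0 : 0 < u by rewrite uE0 mulr_gt0 ?divr_gt0 ?exprn_gt0 //; lra.
have u1 : u <= 1/1000.
  have h : l ^+ 2 / L ^+ 2 <= 1.
    by rewrite ler_pdivrMr ?exprn_gt0 // mul1r lerXn2r ?nnegrE // ltW.
  have h' : 0 <= l ^+ 2 / L ^+ 2 by rewrite divr_ge0 ?sqr_ge0.
  rewrite uE0; apply: le_trans (_ : 1/1000 * (l ^+ 2 / L ^+ 2) <= _); last by clear -h; lra.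
  by rewrite ler_wpM2r //; clear -eta1; lra.
clear uE0 cu0; clearbody q.
have q0 : 0 < q by rewrite qE; clear -u1; lra.
have qt0 t : 0 < q ^+ t by rewrite exprn_gt0.
have qt1 t : q ^+ t <= 1 by rewrite exprn_ile1 // ?ltW // qE; clear -u0; lra.
have c1 : c <= 1/200.
  have : 220 * c * L <= L by have := mulr_ge0 e0 (ltW L0); clear -hc lL; lra.
  by rewrite -ler_pdivlMr // divff ?gt_eqF //; clear; lra.
have dge t : 0 <= d t by rewrite dE dist_ge0.
(* The drift bound is the partial sum of the series [c u q^i], since [u = 1 - q]. The factor [2]
   leaves room for alignments that are only near-optimal. *)
pose inv t := exists P, [/\ P \in unitmx, f t P <= (2 * (q ^+ t * D)) ^+ 2
  & frob (P^T *m P - 1%:M) <= c * (1 - q ^+ t)].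
(* A fresh [tau]-minimiser [P] at time [t] is compared with the old alignment [P0] to bound its
   drift, then kept fixed through the gradient step. *)
have step t tau : 0 < tau -> tau <= (q ^+ t * D) ^+ 2 * u -> d t <= q ^+ t * D -> inv t ->
  exists P, [/\ P \in unitmx, frob (P^T *m P - 1%:M) <= c * (1 - q ^+ t.+1) &
    f t.+1 P <= (1 - 25 * u) * (d t ^+ 2 + tau) + 10 * eta * tau].
  move=> tau0 htau hd [P0 [uP0 hP0 wP0]].
  have [P uP hP] := dist_near_min (X t) Xs (Y t) Ys tau0; rewrite -dE -fE in hP.
  have s0 : 0 <= q ^+ t * D by rewrite mulr_ge0 ?ltW.
  have sD : q ^+ t * D <= D by rewrite ger_pMl.
  have hP' : f t P <= (2 * (q ^+ t * D)) ^+ 2.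
    apply: le_trans hP _.
    have h1 : d t ^+ 2 <= (q ^+ t * D) ^+ 2 by rewrite lerXn2r ?nnegrE.
    have h2 : (q ^+ t * D) ^+ 2 * u <= (q ^+ t * D) ^+ 2 * 1.
      by rewrite ler_wpM2l ?sqr_ge0 //; clear -u1; lra.
    have := sqr_ge0 (q ^+ t * D); clear -h1 h2 htau; lra.
  have s20 : 0 <= 2 * (q ^+ t * D) by clear -s0; lra.
  move: (hP0); rewrite fE => /(le_of_sum_sqr s20) [hx0 _].
  move: (hP'); rewrite fE => /(le_of_sum_sqr s20) [hx _].
  have w1 : c * (1 - q ^+ t) <= 1.
    apply: le_trans (_ : c * 1 <= _); last by clear -c1; lra.
    by rewrite ler_pM2l // gerBl ltW.
  have hw : frob (P^T *m P - 1%:M) <= c * (1 - q ^+ t.+1).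
    apply: le_trans (aligned_drift uP0 (mx_bounds_perturb hXs hx0) _ _ hx0 hx wP0 w1) _.
    - by clear -sD Dl l0; lra.
    - by clear -sD Dl l0; lra.
    (* The drift lemma contributes [24 q^t D / a] with [a >= 9/10 l], below the increment
       [30 q^t D / l]. *)
    have -> : c * (1 - q ^+ t.+1) = c * (1 - q ^+ t) + q ^+ t * (30 * D / l).
      by rewrite -cu exprS qE; ring.
    rewrite lerD2l ler_pdivrMr; last by clear -sD Dl l0; lra.
    apply: le_trans (_ : q ^+ t * (30 * D / l) * (9/10 * l) <= _).
      have -> : q ^+ t * (30 * D / l) * (9/10 * l) = 27 * (q ^+ t * D).
        by field; rewrite gt_eqF.
      clear -s0; lra.
    rewrite ler_wpM2l //; last by clear -sD Dl l0; lra.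
    by rewrite mulr_ge0 ?divr_ge0 ?mulr_ge0 ?ltW.
  exists P; split=> //.
  have wc : c * (1 - q ^+ t.+1) <= c by rewrite -[leRHS]mulr1 ler_pM2l // gerBl ltW.
  rewrite -uE fE hX hY dE.
  have hal : f t P <= (l / 10) ^+ 2.
    by apply: le_trans hP' _; rewrite lerXn2r ?nnegrE //; clear -sD Dl l0; lra.
  rewrite fE in hal hP; rewrite dE in hP.
  have w2 : c * (1 - q ^+ t.+1) <= 1/2 by clear -wc c1; lra.
  apply: le_trans (gd_align_step rip hdelta l0 lL hXs hYs eta0 eta1 uP hal hP hw w2
    ha1 ha2 he1 he2 _) _.
    by have : c * (1 - q ^+ t.+1) * L <= c * L by [rewrite ler_pM2r]; clear -hc; lra.
  rewrite lerD2r ler_wpM2l //.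
  by rewrite uE; clear -u1; lra.
have main t : d t <= q ^+ t * d 0 /\ inv t.
  elim: t => [|t [IH1 IH2]].
    split; first by rewrite expr0 mul1r.
    (* The initial alignment is orthogonal, so its Gram matrix starts with no drift. *)
    exists Q; rewrite expr0 subrr mulr0 mul1r; split.
    - by have [] := mulmx1_unit oQ.
    - by apply: le_trans hQ _; rewrite lerXn2r ?nnegrE //; clear -D0; lra.
    by rewrite oQ subrr -(scale0r 0) frobZ normr0 mul0r.
  have dD : d t <= q ^+ t * D by apply: le_trans IH1 _; rewrite ler_wpM2l ?(ltW (qt0 t)).
  have s0 : 0 < (q ^+ t * D) ^+ 2 by rewrite exprn_gt0 ?mulr_gt0.
  have tau0 : 0 < (q ^+ t * D) ^+ 2 * u by rewrite mulr_gt0.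
  have d2 : d t ^+ 2 <= (q ^+ t * D) ^+ 2 by rewrite lerXn2r ?nnegrE // ?mulr_ge0 ?ltW.
  (* The target rate needs only [1 - 2 u], while a step achieves [1 - 25 u]; the surplus absorbs
     lower-order terms. *)
  have q2 : 1 - 2 * u <= q ^+ 2 by rewrite qE; have := sqr_ge0 u; clear; lra.
  split.
    rewrite exprS -mulrA; apply: le_trans (_ : q * d t <= _); last by rewrite ler_pM2l.
    apply: le_of_sqr; first by rewrite mulr_ge0 ?dge // ltW.
    apply: (le_of_small_slack tau0) => tau tp tle.
    have [P [uP _ hP]] := step t tau tp tle dD IH2.
    rewrite dE; apply: le_trans (dist_sqr_le _ _ _ _ uP) _.
    rewrite -fE; apply: le_trans hP _.
    rewrite exprMn.
    have h1 : (1 - 2 * u) * d t ^+ 2 <= q ^+ 2 * d t ^+ 2 by rewrite ler_wpM2r ?sqr_ge0.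
    have h2 : 0 <= u * d t ^+ 2 by rewrite mulr_ge0 ?sqr_ge0 // ltW.
    have h3 : 0 <= u * tau by rewrite mulr_ge0 ?ltW.
    have h4 : eta * tau <= 1/1000 * tau by rewrite ler_wpM2r // ltW.
    clear -h1 h2 h3 h4 tp; lra.
  (* For the invariant no limit in [tau] is needed: the largest admissible slack still fits in the
     doubled radius. *)
  have [P [uP wP hP]] := step t _ tau0 (lexx _) dD IH2.
  exists P; split=> //; apply: le_trans hP _.
  rewrite (exprS q) -(mulrA q) [leRHS]exprMn [(q * _) ^+ 2]exprMn.
  move: s0 d2; move: ((q ^+ t * D) ^+ 2) (d t ^+ 2) => s x s0 d2.
  have h1 : (1 - 2 * u) * s <= q ^+ 2 * s by rewrite ler_pM2r.
  have h2 : 0 <= u * s by rewrite mulr_ge0 ?ltW.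
  have h3 : eta * (s * u) <= 1/1000 * (s * u) by rewrite ler_wpM2r // mulr_ge0 ?ltW.
  have h4 : (1 - 25 * u) * (x + s * u) <= (1 - 25 * u) * (s + s * u).
    by rewrite ler_wpM2l //; [clear -u1 | clear -d2]; lra.
  have h5 : 0 <= u * (u * s) by rewrite !mulr_ge0 // ltW.
  clear -h1 h2 h3 h4 h5 s0; lra.
by move=> t; have [] := main t; rewrite !dE.
Qed.

End Descent.

(** * Ground-truth factors and initialization *)

Section Factors.
Context {R : realType}.

Lemma frob_orthM n r q (U : 'M[R]_(n, r)) (T : 'M[R]_(r, q)) :
  U^T *m U = 1%:M -> frob (U *m T) = frob T.
Proof. by move=> UU; apply: frob_eq; rewrite mxinnerMl mulmxA UU mul1mx. Qed.

Lemma sqr_frob_factorM n r q (U : 'M[R]_(n, r)) (s : 'I_r -> R) (T : 'M[R]_(r, q)) :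
  U^T *m U = 1%:M -> (forall i, 0 < s i) ->
  frob (U *m diag_mx (\row_i Num.sqrt (s i)) *m T) ^+ 2 = \sum_i \sum_j s i * T i j ^+ 2.
Proof.
move=> UU s0; rewrite -mulmxA frob_orthM // sqr_frob mxinnerE mul_diag_mx.
apply: eq_bigr => i _; apply: eq_bigr => j _; rewrite !mxE -expr2 exprMn sqr_sqrtr //.
exact: ltW.
Qed.

(** [U] is an isometry, so the squared norm of the product is that of [T] with row [i] weighted by
    [s i]. *)
Lemma factor_mx_bounds n r (U : 'M[R]_(n, r)) (s : 'I_r -> R) (a b : R) :
  U^T *m U = 1%:M -> (forall i, 0 < s i) -> 0 < a -> (forall i, a <= s i <= b) -> 0 < b ->
  mx_bounds (U *m diag_mx (\row_i Num.sqrt (s i))) (Num.sqrt a) (Num.sqrt b).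
Proof.
move=> UU s0 a0 sab b0 q T.
have E x : 0 < x -> (Num.sqrt x * frob T) ^+ 2 = \sum_i \sum_j x * T i j ^+ 2.
  move=> x0; rewrite exprMn sqr_sqrtr ?ltW // sqr_frob mxinnerE mulr_sumr.
  by apply: eq_bigr => i _; rewrite mulr_sumr; apply: eq_bigr => j _; rewrite expr2.
by apply/andP; split; apply: le_of_sqr; rewrite ?mulr_ge0 ?frob_ge0 ?sqrtr_ge0 //;
  rewrite E // sqr_frob_factorM //; apply: ler_sum => i _; apply: ler_sum => j _;
  rewrite ler_wpM2r ?sqr_ge0 //; have /andP[] := sab i.
Qed.

Lemma frob_factor_delta n r (U : 'M[R]_(n, r)) (s : 'I_r -> R) i0 :
  U^T *m U = 1%:M -> (forall i, 0 < s i) ->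
  frob (U *m diag_mx (\row_i Num.sqrt (s i)) *m (delta_mx i0 0 : 'cV[R]_r))
  = Num.sqrt (s i0).
Proof.
move=> UU s0; apply/eqP; rewrite -(@eqrXn2 _ 2) ?frob_ge0 ?sqrtr_ge0 //.
rewrite sqr_frob_factorM // sqr_sqrtr ?ltW // (bigD1 i0) //= big_ord1 !mxE !eqxx.
rewrite expr1n mulr1 big1 ?addr0 // => i /negPf ii0.
by rewrite big_ord1 !mxE ii0 expr0n mulr0.
Qed.

Lemma frob_delta_mx r i0 : frob (delta_mx i0 0 : 'cV[R]_r) = 1.
Proof.
apply/eqP; rewrite -(@eqrXn2 _ 2) ?frob_ge0 // expr1n.
rewrite sqr_frob mxinnerE (bigD1 i0) //= big_ord1 !mxE !eqxx mulr1 big1 ?addr0 //.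
by move=> i /negPf ii0; rewrite big_ord1 !mxE ii0 mulr0.
Qed.

Lemma factorM_tr n1 n2 r (U : 'M[R]_(n1, r)) (V : 'M[R]_(n2, r)) (s : 'I_r -> R) :
  (forall i, 0 < s i) ->
  (U *m diag_mx (\row_i Num.sqrt (s i))) *m (V *m diag_mx (\row_i Num.sqrt (s i)))^T
  = U *m diag_mx (\row_i s i) *m V^T.
Proof.
move=> s0; rewrite trmx_mul tr_diag_mx mulmxA -[U *m _ *m _]mulmxA mulmx_diag.
congr (_ *m diag_mx _ *m _); apply/rowP => i.
by rewrite !mxE -expr2 sqr_sqrtr // ltW.
Qed.

Lemma orth_dist_near p r (Z Zs : 'M[R]_(p, r)) (b e : R) :
  orth_dist Z Zs <= b -> b < e -> exists2 Q, orthogonal_mx Q & frob (Z *m Q - Zs) <= e.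
Proof.
move=> hb he.
have hinf : has_inf [set x | exists Q : 'M[R]_r, orthogonal_mx Q /\ x = frob (Z *m Q - Zs)]%classic.
  split; last by exists 0 => x [Q [_ ->]]; exact: frob_ge0.
  by exists (frob (Z *m 1%:M - Zs)), 1%:M; rewrite /orthogonal_mx trmx1 mulmx1.
have e0 : 0 < e - orth_dist Z Zs by lra.
have [x [Q [oQ ->]]] := inf_adherent e0 hinf.
by rewrite -/(orth_dist Z Zs) [ltRHS]addrC subrK => h; exists Q => //; exact: ltW.
Qed.

Lemma sqr_frob_col_mx n1 n2 r (X : 'M[R]_(n1, r)) (Y : 'M[R]_(n2, r)) :
  frob (col_mx X Y) ^+ 2 = frob X ^+ 2 + frob Y ^+ 2.
Proof. by rewrite !sqr_frob /mxinner tr_col_mx mul_row_col mxtraceD. Qed.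

(** Thus an orthogonal alignment acts identically on both factors, and the initialization hypothesis
    bounds the objective of [dist]. *)
Lemma orthogonal_invmx_tr r (Q : 'M[R]_r) : orthogonal_mx Q -> (invmx Q)^T = Q.
Proof.
move=> oQ; have [_ uQ] := mulmx1_unit oQ.
by rewrite -[invmx Q]mul1mx -oQ mulmxK // trmxK.
Qed.

(* [s] is the spectral norm of an initial factor, so [L^2 / s^2] compares the
actual step [eta / s^2] with the ideal one [eta / L^2]. *)
Lemma step_ratio_near (L s D : R) : 0 < L -> 0 < D -> D <= L / 100 ->
  L - D <= s <= L + D ->
  0 <= L ^+ 2 / s ^+ 2 <= 11/10 /\ `|L ^+ 2 / s ^+ 2 - 1| <= 4 * D / L.
Proof.
move=> L0 D0 DL /andP[s1 s2].
have s0 : 0 < s by lra.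
have ss0 : 0 < s ^+ 2 by rewrite exprn_gt0.
have sL : 99/100 * L <= s by lra.
have sL2 : (99/100 * L) ^+ 2 <= s ^+ 2 by rewrite lerXn2r ?nnegrE //; lra.
have L2 : 0 < L ^+ 2 by rewrite exprn_gt0.
split.
  by rewrite divr_ge0 ?sqr_ge0 //= ler_pdivrMr //; lra.
have -> : L ^+ 2 / s ^+ 2 - 1 = (L ^+ 2 - s ^+ 2) / s ^+ 2 by field; rewrite gt_eqF.
rewrite normrM [`|(_ ^+ 2)^-1|]gtr0_norm ?invr_gt0 // ler_pdivrMr //.
apply: le_trans (_ : 3 * D * L <= _).
  by rewrite ler_norml; apply/andP; split; nra.
have -> : 3 * D * L = D / L * (3 * L ^+ 2) by field; rewrite gt_eqF.
have -> : 4 * D / L * s ^+ 2 = D / L * (4 * s ^+ 2) by ring.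
rewrite ler_pM2l ?divr_gt0 //; lra.
Qed.

End Factors.

(** * Geometric convergence from a nearby initialization *)

Section Final.
Context {R : realType}.

Lemma gdS n1 n2 r m (A : 'I_m -> 'M[R]_(n1, n2)) M eta (X0 : 'M[R]_(n1, r))
    (Y0 : 'M[R]_(n2, r)) t
    (Zt := gd A (fun i => mxinner (A i) M) eta X0 Y0 t)
    (G := normal_op A (Zt.1 *m Zt.2^T - M)) :
  gd A (fun i => mxinner (A i) M) eta X0 Y0 t.+1 =
  (Zt.1 - (eta / specnorm Y0 ^+ 2) *: (G *m Zt.2),
   Zt.2 - (eta / specnorm X0 ^+ 2) *: (G^T *m Zt.1)).
Proof.
have residE X Y : resid A (fun i => mxinner (A i) M) X Y = normal_op A (X *m Y^T - M).
  by apply: eq_bigr => i _; rewrite mxinnerDr mxinnerNr.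
by rewrite {}/G /=; move: @Zt; case: (gd _ _ _ _ _ _) => X Y /=; rewrite residE.
Qed.

(** In the application [l] and [L] are the square roots of the extreme singular values, so
    [l^4 / L^3] is [kappa^(-3/2) l], and [v] is a common top direction of both factors. *)
Lemma gd_dist_geometric n1 n2 r m (A : 'I_m -> 'M[R]_(n1, n2)) delta
    (Xs : 'M[R]_(n1, r)) (Ys : 'M[R]_(n2, r)) (v : 'cV[R]_r) l L
    (X0 : 'M[R]_(n1, r)) (Y0 : 'M[R]_(n2, r)) :
  RIP A (2 * r) delta -> delta <= 1/10 -> 0 < l -> l <= L ->
  mx_bounds Xs l L -> mx_bounds Ys l L ->
  frob v = 1 -> frob (Xs *m v) = L -> frob (Ys *m v) = L ->
  orth_dist (col_mx X0 Y0) (col_mx Xs Ys) <= (1/1000) ^+ 3 * (l ^+ 4 / L ^+ 3) ->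
  forall t, let Zt := gd A (fun i => mxinner (A i) (Xs *m Ys^T)) (1/1000) X0 Y0 t in
    dist Zt.1 Xs Zt.2 Ys <= (1 - 1/1000 / 50 * (l ^+ 2 / L ^+ 2)) ^+ t * dist X0 Xs Y0 Ys.
Proof.
move=> rip hdelta l0 lL hXs hYs v1 vX vY.
have L0 : 0 < L by exact: lt_le_trans lL.
(* Doubling the assumed radius gives the strict room needed to pick [Q] without attaining the
   infimum. *)
pose D := 2 * ((1/1000) ^+ 3 * (l ^+ 4 / L ^+ 3)).
have b0 : 0 < (1/1000) ^+ 3 * (l ^+ 4 / L ^+ 3) :> R.
  by rewrite mulr_gt0 ?divr_gt0 ?exprn_gt0 //; lra.
move=> /orth_dist_near /(_ (_ : _ < D)) [|Q oQ hQ]; first by rewrite /D; lra.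
have D0 : 0 < D by rewrite mulr_gt0.
have hl3 : l ^+ 3 <= L ^+ 3 by rewrite lerXn2r ?nnegrE // ltW.
have hlL : l ^+ 4 / L ^+ 3 <= l.
  by rewrite ler_pdivrMr ?exprn_gt0 // exprS ler_pM2l.
have Dl : D <= l / 100.
  have -> : D = 2/1000 * ((1/1000) * ((1/1000) * (l ^+ 4 / L ^+ 3))) by rewrite /D; ring.
  lra.
have QQ : Q *m Q^T = 1%:M by rewrite mulmx1C.
have hQ2 : align_sq X0 Xs Y0 Ys Q <= D ^+ 2.
  rewrite /align_sq orthogonal_invmx_tr // -sqr_frob_col_mx.
  have -> : col_mx (X0 *m Q - Xs) (Y0 *m Q - Ys) = col_mx X0 Y0 *m Q - col_mx Xs Ys.
    by rewrite mul_col_mx opp_col_mx add_col_mx.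
  by rewrite lerXn2r ?nnegrE ?frob_ge0 // ltW.
have [hX hY] : frob (X0 *m Q - Xs) <= D /\ frob (Y0 *m Q - Ys) <= D.
  apply: le_of_sum_sqr; first exact: ltW.
  by move: hQ2; rewrite /align_sq orthogonal_invmx_tr.
have DL : D <= L / 100 by apply: le_trans Dl _; lra.
(* The [X] step is scaled by the norm of [Y0] and the [Y] step by that of [X0], hence the
   crossing. *)
have [ha1 he1] := step_ratio_near L0 D0 DL (specnorm_near oQ hYs v1 vY hY).
have [ha2 he2] := step_ratio_near L0 D0 DL (specnorm_near oQ hXs v1 vX hX).
move=> t; set Z := gd _ _ _ _ _.
apply: (gd_dist_contract (X := fun t => (Z t).1) (Y := fun t => (Z t).2) rip hdelta l0 lL
  hXs hYs _ _ _ _ ha1 ha2 he1 he2 D0 Dl _ oQ hQ2) => //.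
- lra.
- move=> k; rewrite /Z gdS /= mulrA divfK //.
  by rewrite expf_neq0 // gt_eqF.
- move=> k; rewrite /Z gdS /= mulrA divfK //.
  by rewrite expf_neq0 // gt_eqF.
(* Here the exponent [3/2] of [kappa] is spent: it makes the total drift a small multiple of
   [l / L], as aligned descent requires. *)
have -> : 1500 * D * L ^+ 2 / (1/1000 * l ^+ 3) = 3/1000 * (l / L).
  by rewrite /D; field; rewrite !gt_eqF.
have -> : 100 * (22/10 * (3/1000 * (l / L)) + 4 * D / L) * L = 660/1000 * l + 400 * D.
  by field; rewrite gt_eqF.
have -> : D = 2/1000 * ((1/1000) * ((1/1000) * (l ^+ 4 / L ^+ 3))) by rewrite /D; ring.
lra.
Qed.

End Final.

Theorem theorem1 (R : realType) :
  exists c c0 c1 : R, 0 < c /\ 0 < c0 /\ 0 < c1 /\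
  forall (n1 n2 r m : nat)
    (Mstar : 'M[R]_(n1, n2))
    (U : 'M[R]_(n1, r)) (V : 'M[R]_(n2, r)) (s : 'I_r -> R)
    (A : 'I_m -> 'M[R]_(n1, n2))
    (X0 : 'M[R]_(n1, r)) (Y0 : 'M[R]_(n2, r)),
    (0 < r)%N ->
    \rank Mstar = r ->
    (* compact SVD  Mstar = U Sigma V^T *)
    U^T *m U = 1%:M -> V^T *m V = 1%:M ->
    (forall i, 0 < s i) ->
    (forall i j : 'I_r, (i <= j)%N -> s j <= s i) ->
    Mstar = U *m diag_mx (\row_i s i) *m V^T ->
    let Xs := U *m diag_mx (\row_i Num.sqrt (s i)) in
    let Ys := V *m diag_mx (\row_i Num.sqrt (s i)) in
    let smax := \big[Num.max/0]_(i < r) s i in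
    let smin := \big[Num.min/smax]_(i < r) s i in
    let kappa := smax / smin in
    let y := fun i => mxinner (A i) Mstar in
    (exists delta, RIP A (2 * r) delta /\ delta <= c) ->
    orth_dist (col_mx X0 Y0) (col_mx Xs Ys)
      <= c0 * (1 / (kappa * Num.sqrt kappa)) * Num.sqrt smin ->
    forall t : nat,
      let Zt := gd A y c1 X0 Y0 t in
      dist Zt.1 Xs Zt.2 Ys <= (1 - c1 / (50 * kappa)) ^+ t * dist X0 Xs Y0 Ys.
Proof.
exists (1/10), ((1/1000) ^+ 3), (1/1000).
split; first by lra.
split; first by rewrite exprn_gt0 //; lra.
split; first by lra.
move=> n1 n2 r m Mstar U V s A X0 Y0 r0 _ UU VV s0 sdec -> Xs Ys smax smin kappa y
  [delta [rip hdelta]].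
(* The singular values decrease, so the first index carries the largest. *)
pose i0 := Ordinal r0.
have smaxE : smax = s i0.
  apply/eqP; rewrite eq_le; apply/andP; split; last exact: le_bigmax.
  by apply: bigmax_le => [|i _]; [exact: ltW | exact: sdec].
have sle i : smin <= s i by exact: bigmin_le.
have smin0 : 0 < smin.
  by apply/bigmin_gtP; split=> //; rewrite smaxE.
have smm : smin <= smax by rewrite smaxE.
have smax0 : 0 < smax by rewrite smaxE.
have sab i : smin <= s i <= smax by rewrite sle le_bigmax.
have hXs : mx_bounds Xs (Num.sqrt smin) (Num.sqrt smax) by exact: factor_mx_bounds.
have hYs : mx_bounds Ys (Num.sqrt smin) (Num.sqrt smax) by exact: factor_mx_bounds.
have l0 : 0 < Num.sqrt smin by rewrite sqrtr_gt0.
have L0 : 0 < Num.sqrt smax by rewrite sqrtr_gt0.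
have lL : Num.sqrt smin <= Num.sqrt smax by rewrite ler_wsqrtr.
have kE : kappa = Num.sqrt smax ^+ 2 / Num.sqrt smin ^+ 2.
  by rewrite !sqr_sqrtr // ltW.
have skE : Num.sqrt kappa = Num.sqrt smax / Num.sqrt smin.
  by rewrite kE -expr_div_n sqrtr_sqr ger0_norm // divr_ge0 // ltW.
have -> : (1/1000) ^+ 3 * (1 / (kappa * Num.sqrt kappa)) * Num.sqrt smin
  = (1/1000) ^+ 3 * (Num.sqrt smin ^+ 4 / Num.sqrt smax ^+ 3).
  by rewrite skE kE; field; rewrite !gt_eqF.
move=> hinit t.
have vX : frob (Xs *m (delta_mx i0 0 : 'cV[R]_r)) = Num.sqrt smax.
  by rewrite frob_factor_delta // -smaxE.
have vY : frob (Ys *m (delta_mx i0 0 : 'cV[R]_r)) = Num.sqrt smax.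
  by rewrite frob_factor_delta // -smaxE.
have := gd_dist_geometric rip hdelta l0 lL hXs hYs (frob_delta_mx i0) vX vY hinit t.
rewrite factorM_tr //.
have -> : 1/1000 / 50 * (Num.sqrt smin ^+ 2 / Num.sqrt smax ^+ 2) = 1/1000 / (50 * kappa).
  by rewrite kE; field; rewrite !gt_eqF.
by [].
Qed.
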